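(* Let $p,n,N\geq 1$ be natural numbers, let $L_{1},\ldots,L_{N}>0$ and $\alpha_{1},\ldots,\alpha_{N}\in[0,1]$. Consider all families of independent, positive semidefinite $n\times n$ random matrices $X_{1},\ldots,X_{N}$ satisfying $\|X_{k}\|\leq L_{k}$ (almost surely) and $\|\mathbb{E}X_{k}\|=\alpha_{k}L_{k}$ for all $k=1,\ldots,N$. Among all such families, the quantity \[\mathbb{E}\,\mathrm{tr}\left(\sum_{k=1}^{N}X_{k}\right)^{p}\] is maximized when the $X_k$ are independent with $\mathbb{P}(X_{k}=L_{k}I)=\alpha_{k}$ and $\mathbb{P}(X_{k}=0)=1-\alpha_{k}$ for each $k$. That is, this particular family satisfies the constraints, and for every admissible family $X_1,\dots,X_N$ one has $\mathbb{E}\,\mathrm{tr}\left(\sum_{k}X_{k}\right)^{p}\leq \mathbb{E}\,\mathrm{tr}\left(\sum_{k}f_kI\right)^{p}=n\,\mathbb{E}\left(\sum_{k}f_k\right)^{p}$, where $f_1,\dots,f_N$ are independent random variables with $\mathbb{P}(f_k=L_k)=\alpha_k$ and $\mathbb{P}(f_k=0)=1-\alpha_k$.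
   Context: $\|\cdot\|$ denotes the operator norm of a matrix, $\mathrm{tr}$ denotes the (unnormalized) trace of an $n\times n$ matrix, and $I$ is the $n\times n$ identity matrix. *)

(* Defs.v *)
From HB Require Import structures.
From mathcomp Require Import all_boot all_order all_algebra.
From mathcomp Require Import all_classical all_reals all_analysis.
From mathcomp Require Import complex.
Set Implicit Arguments. Unset Strict Implicit. Unset Printing Implicit Defensive.
Import Order.TTheory GRing.Theory Num.Theory.
Local Open Scope classical_set_scope.
Local Open Scope ring_scope.

Section Defs.
Variable R : realType.
Local Notation C := (complex.complex R).

Definition cR (x : R) : C := complex.Complex x 0.

Definition adjmx (m n : nat) (A : 'M[C]_(m, n)) : 'M[C]_(n, m) :=
  (map_mx Num.conj A)^T.

Definition vnorm (n : nat) (v : 'cV[C]_n) : R :=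
  Num.sqrt (complex.Re ((adjmx v *m v) 0 0)).

Definition opnorm (n : nat) (A : 'M[C]_n) : R :=
  sup [set vnorm (A *m v) | v in [set v : 'cV[C]_n | vnorm v <= 1]].

Definition psd (n : nat) (A : 'M[C]_n) : Prop :=
  adjmx A = A /\ forall v : 'cV[C]_n, 0 <= (adjmx v *m A *m v) 0 0.

Definition mx_sigma (T : Type) (n : nat) (X : T -> 'M[C]_n) : set (set T) :=
  <<s [set A : set T | exists (i j : 'I_n) (B : set R), measurable B /\
          (A = (fun t => complex.Re (X t i j)) @^-1` B \/
           A = (fun t => complex.Im (X t i j)) @^-1` B)] >>.

Definition rv_sigma (T : Type) (f : T -> R) : set (set T) :=
  <<s [set f @^-1` B | B in (@measurable _ R)] >>.

(* mutual independence of a finite family of sigma-algebras (sub-sigma-algebras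
   of the measurable sets) under P: product rule for every choice of events;
   subfamilies are covered by choosing the whole space. *)
Definition indep_family d (T : measurableType d) (P : probability T R)
    (N : nat) (G : 'I_N -> set (set T)) : Prop :=
  forall A : 'I_N -> set T, (forall k, G k (A k)) ->
    P (\bigcap_(k in [set: 'I_N]) A k) = (\prod_(k < N) P (A k))%E.

Definition random_mx d (T : measurableType d) (n : nat) (X : T -> 'M[C]_n) : Prop :=
  forall i j, measurable_fun setT (fun t => complex.Re (X t i j)) /\
              measurable_fun setT (fun t => complex.Im (X t i j)).

Definition Emx d (T : measurableType d) (P : probability T R) (n : nat)
    (X : T -> 'M[C]_n) : 'M[C]_n :=
  \matrix_(i, j) complex.Complex (Rintegral P setT (fun t => complex.Re (X t i j)))
                                 (Rintegral P setT (fun t => complex.Im (X t i j))).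

Definition admissible d (T : measurableType d) (P : probability T R) (n N : nat)
    (L alpha : 'I_N -> R) (X : 'I_N -> T -> 'M[C]_n) : Prop :=
  [/\ forall k, random_mx (X k),
      indep_family P (fun k => mx_sigma (X k)),
      forall k, {ae P, forall t, psd (X k t)},
      forall k, {ae P, forall t, opnorm (X k t) <= L k} &
      forall k, opnorm (Emx P (X k)) = alpha k * L k].

(* E tr (sum_k X_k)^p, as an extended real (the trace is real a.s. for psd X_k) *)
Definition Etrpow d (T : measurableType d) (P : probability T R) (n N p : nat)
    (X : 'I_N -> T -> 'M[C]_n) : \bar R :=
  (\int[P]_t (complex.Re (\tr ((\sum_(k < N) X k t) ^+ p)))%:E)%E.

End Defs.

(* Main.v *)
(* One variable is replaced at a time, by means of the deterministic inequality
     tr (A + L X)^p <= tr A^p + tr X ((A + L)^p - A^p)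
   for A >= 0, 0 <= X <= 1 and L >= 0.  Its right-hand side is affine in X, so for
   X independent of A its expectation only involves E X <= alpha; since
   (A + L)^p - A^p >= 0, it is at most (1 - alpha) E tr A^p + alpha E tr (A + L)^p,
   and the Bernoulli family satisfies the same recursion with equality.

   To prove the inequality, expand (A + L X)^p in an eigenbasis of A: it suffices
   that Re tr (X D_1 X D_2 ... X D_m) <= sum_l X_ll D_1(l) ... D_m(l) for diagonal
   matrices D_i >= 0 that are nondecreasing functions of the spectrum of A.  This is
   multilinear in the D_i, which are nonnegative combinations of indicators of upper
   sets of the spectrum; these sets form a chain, and the smallest one dominates. *)
Require Import Defs.
From HB Require Import structures.
From mathcomp Require Import all_boot all_order all_algebra.
From mathcomp Require Import all_classical all_reals all_analysis.
From mathcomp Require Import complex spectral sesquilinear.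
From mathcomp Require Import measurable_realfun ring lra.
Set Implicit Arguments. Unset Strict Implicit. Unset Printing Implicit Defensive.
Import Order.TTheory GRing.Theory Num.Theory.
Local Open Scope ring_scope.

(** * Traces of words in a positive matrix and diagonal matrices *)

(** Words in the noncommuting [A] and [X] may have complex traces, so every estimate concerns real
    parts. In the bound for a word, all [X] but the first are in effect replaced by 1; grouping the
    words by the position of the first [X] gives L sum_j A^j X (A + L)^(p-1-j), whose trace
    telescopes to tr X ((A + L)^p - A^p). A replaced variable becomes zero or L times the identity,
    so it only shifts the remaining sum by a scalar matrix. The comparison is therefore proved for
    tr (S + c I)^p with every c >= 0. The two families may live on different probability spaces:
    they are never coupled, only their recursions are compared. The bounds on the X_k hold almost
    surely, so entries are truncated to make every polynomial expression bounded and integrable. *)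

Section ComplexParts.
Variable R : realType.
Local Notation C := (complex.complex R).
Local Notation Re := (@complex.Re R).
Local Notation Im := (@complex.Im R).

Lemma Re_add (x y : C) : Re (x + y) = Re x + Re y.
Proof. by case: x y => [a b] [c d]. Qed.

Lemma Im_add (x y : C) : Im (x + y) = Im x + Im y.
Proof. by case: x y => [a b] [c d]. Qed.

Lemma Re_mul (x y : C) : Re (x * y) = Re x * Re y - Im x * Im y.
Proof. by case: x y => [a b] [c d]. Qed.

Lemma Im_mul (x y : C) : Im (x * y) = Re x * Im y + Im x * Re y.
Proof. by case: x y => [a b] [c d]. Qed.

Lemma Re_opp (x : C) : Re (- x) = - Re x.
Proof. by case: x. Qed.

Lemma Re_cRl (a : R) (x : C) : Re (cR a * x) = a * Re x.
Proof. by rewrite Re_mul /= mul0r subr0. Qed.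

Lemma Re_sum I (r : seq I) (P : pred I) (F : I -> C) :
  Re (\sum_(i <- r | P i) F i) = \sum_(i <- r | P i) Re (F i).
Proof. exact: (big_morph Re Re_add). Qed.

Lemma Im_sum I (r : seq I) (P : pred I) (F : I -> C) :
  Im (\sum_(i <- r | P i) F i) = \sum_(i <- r | P i) Im (F i).
Proof. exact: (big_morph Im Im_add). Qed.

Lemma Re_conjM (x : C) : Re (Num.conj x * x) = Re x ^+ 2 + Im x ^+ 2.
Proof. by case: x => a b /=; rewrite mulNr opprK !expr2. Qed.

Lemma Re_conj (x : C) : Re (Num.conj x) = Re x.
Proof. by case: x. Qed.

Lemma cRM (a b : R) : cR (a * b) = cR a * cR b.
Proof. exact: (rmorphM (real_complex R)). Qed.

Lemma cRD (a b : R) : cR (a + b) = cR a + cR b.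
Proof. exact: (rmorphD (real_complex R)). Qed.

End ComplexParts.

(** * Real inner products, contractions and matrices between 0 and 1 *)

Section Hermitian.
Variables (R : realType) (n : nat).
Local Notation C := (complex.complex R).
Local Notation Re := (@complex.Re R).
Local Notation Im := (@complex.Im R).
Implicit Types (A X K U : 'M[C]_n) (u v w : 'cV[C]_n).

Lemma adjmxM m k l (A : 'M[C]_(m, k)) (B : 'M[C]_(k, l)) :
  adjmx (A *m B) = adjmx B *m adjmx A.
Proof. by rewrite /adjmx map_mxM trmx_mul. Qed.

Lemma adjmxK m k (A : 'M[C]_(m, k)) : adjmx (adjmx A) = A.
Proof. by apply/matrixP => i j; rewrite !mxE conjCK. Qed.

Lemma adjmxB m k (A B : 'M[C]_(m, k)) : adjmx (A - B) = adjmx A - adjmx B.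
Proof. by rewrite /adjmx map_mxB linearB. Qed.

(** The complex inner product seen as a real symmetric bilinear form; [rip v v] is the squared norm,
    so estimates need no square roots and end in [lra]. *)
Definition rip u v : R := Re ((adjmx u *m v) 0 0).

Lemma ripDr u v w : rip u (v + w) = rip u v + rip u w.
Proof. by rewrite /rip mulmxDr mxE Re_add. Qed.

Lemma ripNr u v : rip u (- v) = - rip u v.
Proof. by rewrite /rip mulmxN mxE Re_opp. Qed.

Lemma rip_sym u v : rip u v = rip v u.
Proof.
rewrite /rip -Re_conj; congr Re.
rewrite -[u in RHS]adjmxK -adjmxM !mxE; congr (Num.conj _).
Qed.

Lemma ripDl u v w : rip (v + w) u = rip v u + rip w u.
Proof. by rewrite rip_sym ripDr !(rip_sym u). Qed.

Lemma ripNl u v : rip (- v) u = - rip v u.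
Proof. by rewrite rip_sym ripNr rip_sym. Qed.

Lemma ripZr u v (c : R) : rip u (cR c *: v) = c * rip u v.
Proof. by rewrite /rip -scalemxAr mxE Re_cRl. Qed.

Lemma ripZl u v (c : R) : rip (cR c *: u) v = c * rip u v.
Proof. by rewrite rip_sym ripZr rip_sym. Qed.

Lemma rip_adj A u v : rip (A *m u) v = rip u (adjmx A *m v).
Proof. by rewrite /rip adjmxM mulmxA. Qed.

Lemma ripvvE v : rip v v = \sum_i (Re (v i 0) ^+ 2 + Im (v i 0) ^+ 2).
Proof.
by rewrite /rip mxE Re_sum; apply: eq_bigr => i _; rewrite !mxE Re_conjM.
Qed.

Lemma ripvv_ge0 v : 0 <= rip v v.
Proof. by rewrite ripvvE sumr_ge0 // => i _; rewrite addr_ge0 ?sqr_ge0. Qed.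

Lemma rip_delta A i : rip (delta_mx i 0) (A *m delta_mx i 0) = Re (A i i).
Proof.
rewrite -colE /rip mxE (bigD1 i) //= big1 => [|j ji]; rewrite !mxE.
  by rewrite !eqxx rmorph1 mul1r addr0.
by rewrite (negbTE ji) rmorph0 mul0r.
Qed.

Definition contractive K := forall v, rip (K *m v) (K *m v) <= rip v v.

Lemma contractive1 : contractive 1%:M.
Proof. by move=> v; rewrite !mul1mx. Qed.

Lemma contractiveM K X : contractive K -> contractive X -> contractive (K *m X).
Proof. by move=> hK hX v; rewrite -!mulmxA (le_trans (hK _)). Qed.

(** Expand the squared norm of v - K v, which is nonnegative, and bound that of K v by that of v. *)
Lemma rip_contractive K v : contractive K -> rip v (K *m v) <= rip v v.
Proof.
move=> /(_ v) hK; have := ripvv_ge0 (v - K *m v).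
rewrite ripDr !ripDl !ripNr !ripNl (rip_sym (K *m v)); lra.
Qed.

Lemma psd_rip A v : psd A -> 0 <= rip v (A *m v).
Proof. by case=> _ /(_ v); rewrite lecE /rip mulmxA => /andP[]. Qed.

Section UnitInterval.
Variable X : 'M[C]_n.
Hypotheses (hX : psd X) (hX1 : psd (1%:M - X)).

(** X - X^2 = (1 - X) X (1 - X) + X (1 - X) X is positive: the two terms are the forms of [X] at v -
    X v and of 1 - X at X v. *)
Lemma ripXX v : rip (X *m v) (X *m v) <= rip v (X *m v).
Proof.
have [aX _] := hX; have := psd_rip (v - X *m v) hX.
have := psd_rip (X *m v) hX1.
rewrite mulmxBl mul1mx mulmxBr !ripDr !ripDl !ripNr !ripNl.
have -> : rip v (X *m (X *m v)) = rip (X *m v) (X *m v) by rewrite rip_adj aX.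
lra.
Qed.

Lemma contractiveX : contractive X.
Proof.
move=> v; apply: le_trans (ripXX v) _.
by have := psd_rip v hX1; rewrite mulmxBl mul1mx ripDr ripNr subr_ge0.
Qed.

(** The entry is the inner product of X e_l with K X e_l; its real part is at most the squared norm
    of X e_l, hence at most X_ll because X^2 <= X. *)
Lemma diag_sandwich K l : contractive K ->
  Re ((X *m K *m X) l l) <= Re (X l l).
Proof.
move=> hK; rewrite -!rip_delta; apply: le_trans (ripXX _).
have [aX _] := hX.
by rewrite -!mulmxA -{1}aX -rip_adj rip_contractive.
Qed.

End UnitInterval.

(** * Diagonal matrices, real traces and words *)

Definition dg (g : 'I_n -> R) : 'M[C]_n := diag_mx (\row_i cR (g i)).

Lemma dgE g i j : dg g i j = (cR (g i)) *+ (i == j).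
Proof. by rewrite !mxE; case: eqP => // ->. Qed.

Lemma dgM f g : dg f *m dg g = dg (fun i => f i * g i).
Proof.
by rewrite mulmx_diag; congr diag_mx; apply/rowP => i; rewrite !mxE cRM.
Qed.

Lemma dgD f g : dg f + dg g = dg (fun i => f i + g i).
Proof.
by rewrite -linearD; congr diag_mx; apply/rowP => i; rewrite !mxE cRD.
Qed.

Lemma dgZ c g : cR c *: dg g = dg (fun i => c * g i).
Proof.
by rewrite -linearZ; congr diag_mx; apply/rowP => i; rewrite !mxE cRM.
Qed.

Lemma dgB f g : dg f - dg g = dg (fun i => f i - g i).
Proof.
rewrite -linearB; congr diag_mx; apply/rowP => i; rewrite !mxE.
exact: (esym (rmorphB (real_complex R) _ _)).
Qed.

Lemma dg_cst c : dg (fun=> c) = (cR c)%:M.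
Proof. by apply/matrixP => i j; rewrite dgE !mxE. Qed.

Lemma dg_exp f k : dg f ^+ k = dg (fun i => f i ^+ k).
Proof.
elim: k => [|k IH]; first by rewrite expr0 dg_cst.
by rewrite exprS IH [LHS]dgM; congr dg; apply: funext => i; rewrite exprS.
Qed.

Lemma contractive_dg g : (forall i, 0 <= g i <= 1) -> contractive (dg g).
Proof.
move=> hg v; rewrite !ripvvE; apply: ler_sum => i _.
rewrite mul_diag_mx !mxE Re_mul Im_mul /= !mul0r subr0 addr0 !exprMn -mulrDr.
apply: ler_piMl; first by rewrite addr_ge0 ?sqr_ge0.
by have /andP[? ?] := hg i; rewrite exprn_ile1.
Qed.

Definition rtr A : R := Re (\tr A).

Lemma rtrE A : rtr A = \sum_i Re (A i i).
Proof. exact: Re_sum. Qed.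

Lemma rtrD A X : rtr (A + X) = rtr A + rtr X.
Proof. by rewrite /rtr mxtraceD Re_add. Qed.

Lemma rtrZ c A : rtr (cR c *: A) = c * rtr A.
Proof. by rewrite /rtr mxtraceZ Re_cRl. Qed.

Lemma rtr_mulC A X : rtr (A *m X) = rtr (X *m A).
Proof. by rewrite /rtr mxtrace_mulC. Qed.

Lemma rtr_dg g A : rtr (dg g *m A) = \sum_i g i * Re (A i i).
Proof.
by rewrite rtrE; apply: eq_bigr => i _; rewrite mul_diag_mx !mxE Re_cRl.
Qed.

Definition ind (S : {set 'I_n}) (i : 'I_n) : R := (i \in S)%:R.

Lemma ind_bounds S i : 0 <= ind S i <= 1.
Proof. by rewrite /ind ler0n lern1 leq_b1. Qed.

Definition word X (gs : seq ('I_n -> R)) : 'M[C]_n :=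
  foldr (fun g W => X *m dg g *m W) 1%:M gs.

Lemma word_cat X gs hs : word X (gs ++ hs) = word X gs *m word X hs.
Proof. by elim: gs => [|g gs IH] /=; rewrite ?mul1mx // IH mulmxA. Qed.

Lemma contractive_word X (ss : seq {set 'I_n}) :
  contractive X -> contractive (word X (map ind ss)).
Proof.
move=> hX; elim: ss => [|S ss IH] /=; first exact: contractive1.
by rewrite -mulmxA; do 2?apply: contractiveM => //; apply: contractive_dg => i;
  exact: ind_bounds.
Qed.

Lemma chain_min (ss : seq {set 'I_n}) : ss != [::] ->
  {in ss &, forall S T : {set 'I_n}, S \subset T \/ T \subset S} ->
  exists2 S, S \in ss & {in ss, forall T : {set 'I_n}, S \subset T}.
Proof.
elim: ss => // S ss IH _ chain.
have [->|ss0] := eqVneq ss [::].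
  by exists S; rewrite ?mem_head // => T; rewrite inE => /eqP ->.
have [|M Mss hM] := IH ss0.
  by move=> A B hA hB; apply: chain; rewrite inE ?hA ?hB orbT.
have [] := chain S M; rewrite ?mem_head ?inE ?Mss ?orbT // => sub.
  exists S; rewrite ?mem_head // => T; rewrite inE => /predU1P[->//|/hM].
  exact: (fintype.subset_trans sub).
exists M; rewrite ?inE ?Mss ?orbT // => T; rewrite inE => /predU1P[->//|].
exact: hM.
Qed.

(* Rotating the smallest projection P to the front, the trace is that of
   P X K X with K a contraction, so it is at most tr (P X^2) <= tr (P X). *)
Lemma word_chain X (ss : seq {set 'I_n}) : psd X -> psd (1%:M - X) ->
  ss != [::] -> {in ss &, forall S T : {set 'I_n}, S \subset T \/ T \subset S} ->
  rtr (word X (map ind ss)) <= \sum_i Re (X i i) * \prod_(S <- ss) ind S i.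
Proof.
move=> hX hX1 ss0 chain; have [S Sss hS] := chain_min ss0 chain.
have X0 i : 0 <= Re (X i i) by rewrite -rip_delta psd_rip.
have -> : \sum_i Re (X i i) * \prod_(T <- ss) ind T i
        = \sum_i ind S i * Re (X i i).
  apply: eq_bigr => i _; rewrite mulrC; congr (_ * _).
  have [iS|iS] := boolP (i \in S).
    rewrite /ind iS big_seq big1 // => T Tss.
    by rewrite (fintype.subsetP (hS T Tss)).
  by rewrite (big_rem S) //= /ind (negbTE iS) mul0r.
case/splitPr: Sss => s1 s2.
have -> : rtr (word X (map ind (s1 ++ S :: s2)))
        = rtr (dg (ind S) *m (word X (map ind (s2 ++ s1)) *m X)).
  rewrite !map_cat !word_cat /= rtr_mulC -!mulmxA rtr_mulC.
  by rewrite !mulmxA.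
rewrite rtr_dg; apply: ler_sum => i _.
have /andP[S0 _] := ind_bounds S i; apply: ler_wpM2l => //.
(* A one-letter word contains a single [X] and gives equality; otherwise what lies between the two
   outer [X] is the contraction K. *)
case: (s2 ++ s1) => [|T s] /=; first by rewrite mul1mx.
rewrite -(mulmxA X); apply: diag_sandwich => //; apply: contractiveM.
  by apply: contractive_dg => j; exact: ind_bounds.
by apply: contractive_word; exact: contractiveX.
Qed.

(** * Letters that are nondecreasing in the spectrum *)

Section Comonotone.
Variable lam : 'I_n -> R.

(** Indices with equal [lam] receive equal values, so such a [g] is a nonnegative nondecreasing
    function of the spectrum. *)
Definition comonotone (g : 'I_n -> R) :=
  (forall i, 0 <= g i) /\ (forall i j, lam i <= lam j -> g i <= g j).

Definition upset (S : {set 'I_n}) :=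
  forall i j, lam i <= lam j -> i \in S -> j \in S.

Lemma upset_chain S T : upset S -> upset T -> S \subset T \/ T \subset S.
Proof.
move=> hS hT; have [|/fintype.subsetPn[i iS iT]] := boolP (S \subset T); first by left.
right; apply/fintype.subsetP => j jT; case/orP: (le_total (lam i) (lam j)) => ij.
  exact: hS iS.
by case/negP: iT; exact: hT jT.
Qed.

Lemma comonotoneM f g : comonotone f -> comonotone g ->
  comonotone (fun i => f i * g i).
Proof.
move=> [f0 fm] [g0 gm]; split=> [i|i j ij]; first exact: mulr_ge0.
by apply: ler_pM => //; [exact: fm|exact: gm].
Qed.

(** Layer-cake induction: subtract from [g] its least nonzero value times the indicator of its
    support. The support is an upper set, the remainder is again comonotone, and its support has
    lost the index where the minimum is attained. *)
Lemma comonotone_ind (Pr : ('I_n -> R) -> Prop) :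
  Pr (fun=> 0) ->
  (forall S c g, upset S -> 0 <= c -> Pr g -> Pr (fun i => c * ind S i + g i)) ->
  forall g, comonotone g -> Pr g.
Proof.
move=> Pr0 PrS g; have [m] := ubnP #|[set i | g i != 0]|.
elim: m g => // m IH g; rewrite ltnS => card_g [g0 gm].
set S := [set i | g i != 0] in card_g *.
have [S0|[k kS]] := set_0Vmem S.
  suff -> : g = fun=> 0 by [].
  apply: funext => i; have : i \notin S by rewrite S0 inE.
  by rewrite inE negbK => /eqP.
have [i0 i0S hi0] := arg_minP g kS.
have upS : upset S.
  move=> i j ij; rewrite !inE => gi; rewrite gt_eqF //.
  by apply: lt_le_trans (gm _ _ ij); rewrite lt_neqAle eq_sym gi g0.
pose h i := g i - g i0 * ind S i.
have -> : g = fun i => g i0 * ind S i + h i.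
  by apply: funext => i; rewrite /h addrC subrK.
apply: PrS => //; apply: IH.
  apply: leq_trans card_g; apply: proper_card; apply/fintype.properP.
  split; last by exists i0 => //; rewrite inE negbK /h /ind (_ : i0 \in S) ?mulr1 ?subrr.
  apply/fintype.subsetP => i; rewrite !inE; apply: contra => /eqP gi.
  by rewrite /h /ind inE gi eqxx mulr0 subrr.
split=> [i|i j ij]; rewrite /h /ind.
  have [iS|] := boolP (i \in S); first by rewrite mulr1 subr_ge0 hi0.
  by rewrite mulr0 subr0.
have [iS|] := boolP (i \in S).
  by rewrite (upS _ _ ij iS) lerB // gm.
rewrite inE negbK => /eqP ->; rewrite mulr0 subr0.
by case: (boolP (j \in S)) => [/hi0|]; rewrite ?mulr1 ?mulr0 ?subr0 // subr_ge0.
Qed.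

Variable X : 'M[C]_n.
Hypotheses (hX : psd X) (hX1 : psd (1%:M - X)).

Lemma word_lincomb gs c f g hs :
  rtr (word X (gs ++ (fun i => c * f i + g i) :: hs))
  = c * rtr (word X (gs ++ f :: hs)) + rtr (word X (gs ++ g :: hs)).
Proof.
rewrite !word_cat /= -dgD -dgZ mulmxDr mulmxDl mulmxDr rtrD; congr (_ + _).
by rewrite -!(scalemxAr, scalemxAl) rtrZ.
Qed.

Lemma word_comonotone gs : gs != [::] ->
  (forall k, (k < size gs)%N -> comonotone (nth (fun=> 0) gs k)) ->
  rtr (word X gs) <= \sum_i Re (X i i) * \prod_(g <- gs) g i.
Proof.
(* The letters in [ss] are already indicators, those in [hs] are still general. The induction on
   [hs] decomposes its first letter and passes each indicator to the end of [ss]. *)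
suff main ss hs : map ind ss ++ hs != [::] ->
    (forall S, S \in ss -> upset S) ->
    (forall k, (k < size hs)%N -> comonotone (nth (fun=> 0) hs k)) ->
    rtr (word X (map ind ss ++ hs))
    <= \sum_i Re (X i i) * \prod_(g <- map ind ss ++ hs) g i.
  by move=> gs0 hgs; exact: (main [::]).
elim: hs ss => [|h hs IH] ss ne hss hhs.
  rewrite !cats0; under eq_bigr do rewrite big_map.
  apply: word_chain => //; first by move: ne; rewrite cats0; case: (ss).
  by move=> S T /hss hS /hss hT; exact: upset_chain.
have hhs' k : (k < size hs)%N -> comonotone (nth (fun=> 0) hs k).
  by move=> hk; exact: (hhs k.+1).
move: (hhs 0%N (ltn0Sn _)) => /=; move: h {hhs ne}.
apply: comonotone_ind => [|S c g hS c0 IHg].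
  rewrite word_cat /= dg_cst /rtr (_ : cR 0 = 0) // raddf0 mulmx0 mul0mx mulmx0.
  rewrite mxtrace0 /= sumr_ge0 // => i _.
  by rewrite big_cat big_cons /= mul0r mulr0 mulr0.
rewrite word_lincomb.
apply: (@le_trans _ _ (c * (\sum_i Re (X i i) *
     \prod_(g <- map ind ss ++ ind S :: hs) g i) +
   \sum_i Re (X i i) * \prod_(g <- map ind ss ++ g :: hs) g i)).
  apply: lerD => //; apply: ler_wpM2l => //.
  rewrite -cat_rcons -map_rcons; apply: IH => //.
    by rewrite map_rcons; case: (map _ _).
  by move=> T; rewrite mem_rcons inE => /predU1P[->|/hss].
rewrite mulr_sumr -big_split /=; apply: ler_sum => i _.
by rewrite !big_cat !big_cons /= le_eqVlt; apply/orP; left; apply/eqP; ring.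
Qed.

Hypothesis lam0 : forall i, 0 <= lam i.

Lemma comonotone_lam : comonotone lam.
Proof. by split. Qed.

Lemma comonotone1 : comonotone (fun=> 1).
Proof. by split. Qed.

Lemma comonotone_exp k : comonotone (fun i => lam i ^+ k).
Proof.
elim: k => [|k IH]; first by under eq_fun do rewrite expr0; exact: comonotone1.
by under eq_fun do rewrite exprS; exact: comonotoneM comonotone_lam IH.
Qed.

Variable L : R.
Hypothesis L0 : 0 <= L.

(** Expand the power one factor at a time: [dg lam] is absorbed into the last letter [f], and [X]
    opens a new letter 1. In the bound every [X] after the first has become 1, hence the power of
    [lam i + L]; [h] records what precedes the first [X]. *)
Lemma word_pow q h f gs : comonotone h -> comonotone f ->
  (forall k, (k < size gs)%N -> comonotone (nth (fun=> 0) gs k)) ->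
  rtr (dg h *m word X (rcons gs f) *m (dg lam + cR L *: X) ^+ q)
  <= \sum_i Re (X i i) *
       (h i * (\prod_(g <- rcons gs f) g i) * (lam i + L) ^+ q).
Proof.
elim: q f gs => [|q IH] f gs hh hf hgs.
  (* By cyclicity [h] moves to the end and multiplies the last letter, which leaves a plain word
     with comonotone letters. *)
  rewrite expr0 mulmx1 rtr_mulC -cats1 word_cat -mulmxA /= mulmx1 -mulmxA dgM.
  have -> : X *m dg (fun i => f i * h i) = word X [:: fun i => f i * h i].
    by rewrite /= mulmx1.
  rewrite -word_cat; apply: le_trans (word_comonotone _ _) _.
  - by case: (gs).
  - move=> k; rewrite size_cat addn1 ltnS leq_eqVlt => /predU1P[->|kgs].
      by rewrite nth_cat ltnn subnn; exact: comonotoneM.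
    by rewrite nth_cat kgs; exact: hgs.
  rewrite le_eqVlt; apply/orP; left; apply/eqP; apply: eq_bigr => i _.
  by rewrite !big_cat !big_seq1 /=; ring.
rewrite exprS mulrDl; set E := _ ^+ q.
have -> : dg h *m word X (rcons gs f) *m (dg lam * E + cR L *: X * E)
   = dg h *m word X (rcons gs (fun i => f i * lam i)) *m E
     + cR L *: (dg h *m word X (rcons (rcons gs f) (fun=> 1)) *m E).
  rewrite mulmxDr; congr (_ + _).
    by rewrite -!cats1 !word_cat /= !mulmx1 -dgM !mulmxA.
  rewrite -[_ * E]/(_ *m _) -!cats1 !word_cat /= !mulmx1 dg_cst mulmx1.
  by rewrite -!scalemxAl -!scalemxAr !mulmxA.
rewrite rtrD rtrZ.
have hf' : comonotone (fun i => f i * lam i).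
  by apply: comonotoneM => //; exact: comonotone_lam.
have IH1 := IH _ _ hh hf' hgs.
have hgs' k : (k < size (rcons gs f))%N ->
    comonotone (nth (fun=> 0) (rcons gs f) k).
  rewrite size_rcons ltnS nth_rcons leq_eqVlt => /predU1P[->|kgs].
    by rewrite ltnn eqxx.
  by rewrite kgs; exact: hgs.
have IH2 := IH _ _ hh comonotone1 hgs'.
apply: le_trans (lerD IH1 (ler_wpM2l L0 IH2)) _.
rewrite mulr_sumr -big_split /=; apply: ler_sum => i _.
rewrite -!cats1 !big_cat !big_seq1 /= exprS.
by rewrite le_eqVlt; apply/orP; left; apply/eqP; ring.
Qed.

(** Cut each word at its first [X]: the word without one gives [lam i ^+ (k + q)] exactly, the
    others are bounded by [word_pow]. The increments telescope by lam ((lam + L)^q - lam^q) + L (lam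
    + L)^q = (lam + L)^(q+1) - lam^(q+1). *)
Lemma dg_pow_bound q k :
  rtr (dg lam ^+ k *m (dg lam + cR L *: X) ^+ q)
  <= \sum_i (lam i ^+ (k + q) +
       Re (X i i) * (lam i ^+ k * ((lam i + L) ^+ q - lam i ^+ q))).
Proof.
elim: q k => [|q IH] k.
  rewrite expr0 mulmx1 dg_exp rtrE; apply: ler_sum => i _.
  by rewrite dgE eqxx !expr0 subrr !mulr0 addr0 addn0.
rewrite exprS mulrDl; set E := _ ^+ q.
have -> : dg lam ^+ k *m (dg lam * E + cR L *: X * E)
   = dg lam ^+ k.+1 *m E + cR L *: (dg (fun i => lam i ^+ k) *m X *m E).
  rewrite mulmxDr; congr (_ + _); first by rewrite exprSr -mulmxA.
  rewrite -dg_exp -[_ * E]/(_ *m _).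
  by rewrite -!scalemxAl -!scalemxAr !mulmxA.
rewrite rtrD rtrZ.
have IH2 := @word_pow q _ _ [::] (comonotone_exp k) comonotone1 _.
move: IH2; rewrite /= dg_cst !mulmx1 => IH2.
apply: le_trans (lerD (IH k.+1) (ler_wpM2l L0 (IH2 _))) _ => //.
rewrite mulr_sumr -big_split /=; apply: ler_sum => i _.
rewrite big_seq1 addSnnS !exprS exprD.
by rewrite le_eqVlt; apply/orP; left; apply/eqP; ring.
Qed.

End Comonotone.

(** * The trace inequality for positive matrices *)

Lemma psd_conj U A : psd A -> psd (U *m A *m adjmx U).
Proof.
move=> [aA pA]; split.
  by rewrite !adjmxM adjmxK aA mulmxA.
move=> v; have := pA (adjmx U *m v).
by rewrite adjmxM adjmxK !mulmxA.
Qed.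

(** The spectral theorem for normal matrices, with eigenvalues made real: they are the diagonal
    entries of a conjugate of [A], which is positive. *)
Lemma psd_spectral A : psd A -> exists U (lam : 'I_n -> R),
  [/\ U *m adjmx U = 1%:M, adjmx U *m U = 1%:M, forall i, 0 <= lam i &
      A = adjmx U *m dg lam *m U].
Proof.
move=> hA; have [aA pA] := hA.
have hermA : A \is hermsymmx.
  apply/is_hermitianmxP; rewrite expr0 scale1r -[LHS]aA.
  by rewrite /adjmx map_trmx.
have hN := hermitian_normalmx hermA.
have /orthomx_spectralP Aeq := hN.
have hU := spectral_unitarymx A; rewrite (invmx_unitary hU) in Aeq.
set U := spectralmx A in Aeq hU; set sp := spectral_diag A in Aeq.
have Ut : map_mx Num.conj U^T = adjmx U by rewrite /adjmx map_trmx.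
have UV : U *m adjmx U = 1%:M by have /unitarymxP := hU; rewrite Ut.
have VU : adjmx U *m U = 1%:M by exact: mulmx1C.
rewrite Ut in Aeq.
have spE : diag_mx sp = U *m A *m adjmx U.
  by rewrite Aeq !mulmxA UV mul1mx -mulmxA UV mulmx1.
have sp0 i : 0 <= sp 0 i.
  have [_ /(_ (delta_mx i 0))] := psd_conj U hA.
  rewrite -spE -mulmxA -colE mxE (bigD1 i) //= big1 => [|j ji]; rewrite !mxE.
    by rewrite !eqxx rmorph1 mul1r mulr1n addr0.
  by rewrite (negbTE ji) rmorph0 mul0r.
exists U, (fun i => Re (sp 0 i)); split; [exact: UV|exact: VU|move=> i|].
  by have := sp0 i; rewrite lecE => /andP[].
rewrite Aeq; congr (_ *m _ *m _); congr diag_mx.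
apply/rowP => i; rewrite mxE; move: (sp0 i); rewrite lecE => /andP[/eqP /= im0 _].
by apply/eqP; rewrite eq_complex /= im0 !eqxx.
Qed.

Lemma conjmx_exp U A k : U *m adjmx U = 1%:M -> adjmx U *m U = 1%:M ->
  (adjmx U *m A *m U) ^+ k = adjmx U *m A ^+ k *m U.
Proof.
move=> UV VU; elim: k => [|k IH]; first by rewrite !expr0 mulmx1 VU.
rewrite !exprS IH -[LHS]/(_ *m _) !mulmxA; congr (_ *m _ *m _).
by rewrite -mulmxA UV mulmx1.
Qed.

Lemma rtr_conj U A : U *m adjmx U = 1%:M -> rtr (adjmx U *m A *m U) = rtr A.
Proof. by move=> UV; rewrite rtr_mulC mulmxA UV mul1mx. Qed.

Section PsdTrace.
Variables (A X : 'M[C]_n) (L : R).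
Hypotheses (hA : psd A) (hX : psd X) (L0 : 0 <= L).

(** In an eigenbasis of [A] the increment of the power is diagonal, so the trace only sees the
    diagonal of the conjugated [X]. *)
Lemma rtr_pow_incr_spectral p U (lam : 'I_n -> R) :
  U *m adjmx U = 1%:M -> adjmx U *m U = 1%:M -> A = adjmx U *m dg lam *m U ->
  rtr (X *m ((A + (cR L)%:M) ^+ p - A ^+ p)) =
  \sum_i Re ((U *m X *m adjmx U) i i) * ((lam i + L) ^+ p - lam i ^+ p).
Proof.
move=> UV VU Aeq.
have -> : A + (cR L)%:M = adjmx U *m dg (fun i => lam i + L) *m U.
  rewrite -dgD mulmxDr mulmxDl -Aeq dg_cst; congr (_ + _).
  by rewrite mul_mx_scalar -scalemxAl VU scalemx1.
rewrite Aeq !(conjmx_exp _ _ UV VU) !dg_exp -mulmxBl -mulmxBr dgB.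
rewrite rtr_mulC -!mulmxA rtr_mulC -!mulmxA rtr_dg.
by apply: eq_bigr => i _; rewrite mulrC !mulmxA.
Qed.

Lemma rtr_pow_incr_ge0 p : 0 <= rtr (X *m ((A + (cR L)%:M) ^+ p - A ^+ p)).
Proof.
have [U [lam [UV VU lam0 Aeq]]] := psd_spectral hA.
rewrite (rtr_pow_incr_spectral p UV VU Aeq); apply: sumr_ge0 => i _.
apply: mulr_ge0; first by rewrite -rip_delta; exact: (psd_rip _ (psd_conj U hX)).
by rewrite subr_ge0 lerXn2r ?nnegrE ?addr_ge0 // lerDl.
Qed.

(** Conjugation into the eigenbasis preserves 0 <= X <= 1 and the traces of powers, which leaves
    [dg_pow_bound] with k = 0. *)
Lemma rtr_pow_le p : psd (1%:M - X) ->
  rtr ((A + cR L *: X) ^+ p)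
  <= rtr (A ^+ p) + rtr (X *m ((A + (cR L)%:M) ^+ p - A ^+ p)).
Proof.
move=> hX1; have [U [lam [UV VU lam0 Aeq]]] := psd_spectral hA.
rewrite (rtr_pow_incr_spectral p UV VU Aeq).
set Y := U *m X *m adjmx U.
have hY : psd Y by exact: psd_conj.
have hY1 : psd (1%:M - Y).
  have -> : 1%:M - Y = U *m (1%:M - X) *m adjmx U.
    by rewrite mulmxBr mulmxBl mulmx1 UV.
  exact: psd_conj.
have -> : A + cR L *: X = adjmx U *m (dg lam + cR L *: Y) *m U.
  rewrite mulmxDr mulmxDl -Aeq -scalemxAr -scalemxAl /Y; congr (_ + _ *: _).
  by rewrite !mulmxA VU mul1mx -mulmxA VU mulmx1.
rewrite [in leRHS]Aeq !(conjmx_exp _ _ UV VU) !(rtr_conj _ UV).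
have := dg_pow_bound hY hY1 lam0 L0 p 0; rewrite expr0 mul1mx => /le_trans; apply.
rewrite big_split /= dg_exp rtrE; apply: lerD; apply: ler_sum => i _.
  by rewrite dgE eqxx.
by rewrite expr0 mul1r.
Qed.

End PsdTrace.
End Hermitian.

(** * The operator norm *)

Section OperatorNorm.
Variables (R : realType) (n : nat).
Local Notation C := (complex.complex R).
Local Notation Re := (@complex.Re R).
Local Notation Im := (@complex.Im R).
Implicit Types (A : 'M[C]_n) (u v : 'cV[C]_n).

Lemma vnormE v : vnorm v = Num.sqrt (rip v v).
Proof. by []. Qed.

Lemma vnorm_le v c : 0 <= c -> (vnorm v <= c) = (rip v v <= c ^+ 2).
Proof.
move=> c0; rewrite vnormE -[c in LHS]ger0_norm // -sqrtr_sqr.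
by rewrite ler_sqrt ?sqr_ge0.
Qed.

Lemma rip0 : rip (0 : 'cV[C]_n) 0 = 0.
Proof. by rewrite /rip mulmx0 mxE. Qed.

Lemma rip_entry v i : Re (v i 0) ^+ 2 + Im (v i 0) ^+ 2 <= rip v v.
Proof.
rewrite ripvvE (bigD1 i) //= lerDl sumr_ge0 // => j _.
by rewrite addr_ge0 ?sqr_ge0.
Qed.

Lemma normr_le_sqr (a b c : R) : 0 <= c -> a ^+ 2 + b ^+ 2 <= c ^+ 2 ->
  `|a| <= c /\ `|b| <= c.
Proof.
move=> c0 h.
have h1 (x : R) : x ^+ 2 <= c ^+ 2 -> `|x| <= c.
  by move=> hx; rewrite -(ger0_norm c0) -!sqrtr_sqr ler_sqrt ?sqr_ge0.
by split; apply: h1; apply: le_trans h; rewrite ?lerDl ?lerDr sqr_ge0.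
Qed.

(** [opnorm] is a supremum of reals, hence an upper bound only once the set is known to be bounded.
    A crude constant suffices: [b i] bounds the real and the imaginary part of row i of A v. *)
Lemma vnorm_mulmx_bounded A : exists M, forall v, vnorm v <= 1 -> vnorm (A *m v) <= M.
Proof.
pose b i := \sum_j (`|Re (A i j)| + `|Im (A i j)|).
exists (Num.sqrt (\sum_i (b i ^+ 2 + b i ^+ 2))) => v.
rewrite vnorm_le // expr1n => v1.
rewrite vnormE ler_sqrt; last first.
  by apply: sumr_ge0 => i _; rewrite addr_ge0 ?sqr_ge0.
have hv j : `|Re (v j 0)| <= 1 /\ `|Im (v j 0)| <= 1.
  by apply: normr_le_sqr => //; rewrite expr1n (le_trans (rip_entry v j)).
have b0 i : 0 <= b i by apply: sumr_ge0 => j _; rewrite addr_ge0.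
rewrite ripvvE; apply: ler_sum => i _.
have sq (x : R) : `|x| <= b i -> x ^+ 2 <= b i ^+ 2.
  by move=> hx; rewrite -real_normK ?num_real // lerXn2r ?nnegrE.
apply: lerD; apply: sq; rewrite mxE ?Re_sum ?Im_sum;
  apply: le_trans (ler_norm_sum _ _ _) _; apply: ler_sum => j _;
  have [h1 h2] := hv j.
  rewrite Re_mul; apply: le_trans (ler_normB _ _) _; rewrite !normrM.
  by apply: lerD; apply: ler_piMr.
rewrite Im_mul addrC; apply: le_trans (ler_normD _ _) _; rewrite !normrM addrC.
by apply: lerD; apply: ler_piMr.
Qed.

Lemma vnorm_le_opnorm A v : vnorm v <= 1 -> vnorm (A *m v) <= opnorm A.
Proof.
move=> v1; apply: ub_le_sup; last by exists v.
have [M hM] := vnorm_mulmx_bounded A.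
by exists M => _ [u u1 <-]; exact: hM.
Qed.

Lemma opnorm_ge0 A : 0 <= opnorm A.
Proof.
apply: (@le_trans _ _ (vnorm (A *m 0))); first exact: sqrtr_ge0.
by apply: vnorm_le_opnorm; rewrite vnorm_le // rip0 expr1n.
Qed.

Lemma rip_mulmx_opnorm A v : rip (A *m v) (A *m v) <= opnorm A ^+ 2 * rip v v.
Proof.
have [v0|v0] := eqVneq (rip v v) 0.
  have -> : v = 0.
    apply/matrixP => i j; rewrite ord1 mxE; apply/eqP.
    have := rip_entry v i; rewrite v0 => h.
    have r2 := sqr_ge0 (Re (v i 0)); have i2 := sqr_ge0 (Im (v i 0)).
    rewrite eq_complex /= -[X in X && _]sqrf_eq0 -[X in _ && X]sqrf_eq0.
    by apply/andP; split; apply/eqP; lra.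
  by rewrite mulmx0 rip0 mulr0.
have vp : 0 < rip v v by rewrite lt_neqAle eq_sym v0 ripvv_ge0.
have sp : 0 < Num.sqrt (rip v v) by rewrite sqrtr_gt0.
pose s := (Num.sqrt (rip v v))^-1.
have s2 : s ^+ 2 * rip v v = 1.
  by rewrite /s exprVn sqr_sqrtr ?ltW // mulVf.
have : vnorm (A *m (cR s *: v)) <= opnorm A.
  by apply: vnorm_le_opnorm; rewrite vnorm_le // ripZl ripZr mulrA -expr2 s2 expr1n.
rewrite vnorm_le ?opnorm_ge0 // -scalemxAr ripZl ripZr mulrA -expr2 => h.
rewrite -ler_pdivrMr // mulrC; apply: le_trans h; rewrite ler_wpM2r ?ripvv_ge0 //.
by rewrite /s exprVn sqr_sqrtr ?(ltW vp) // lexx.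
Qed.

(** Expanding the squared norm of c v - A v gives 2 c <v, A v> <= c^2 <v, v> + <A v, A v> <= 2 c^2
    <v, v> for c at least the norm. Dividing by c needs c > 0, whereas the norm may vanish. *)
Lemma rip_le_opnorm A v : rip v (A *m v) <= opnorm A * rip v v.
Proof.
have c0 := opnorm_ge0 A; have r0 := ripvv_ge0 v.
have hA := rip_mulmx_opnorm A v.
(* [c] exceeds the norm by so little that c <v, v> exceeds the target by at most [e]; the added 1
   covers v = 0. *)
apply/ler_addgt0Pr => e e0; pose c := opnorm A + e / (rip v v + 1).
have d0 : 0 < e / (rip v v + 1) by rewrite divr_gt0 // ltr_wpDl.
have cp : 0 < c by rewrite ltr_wpDl.
have : rip v (A *m v) <= c * rip v v.
  have := ripvv_ge0 (cR c *: v - A *m v).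
  rewrite ripDr !ripDl !ripNr !ripNl (rip_sym (A *m v)) ?(ripZl, ripZr) => h.
  have h2 : opnorm A ^+ 2 * rip v v <= c ^+ 2 * rip v v.
    by rewrite ler_wpM2r // lerXn2r ?nnegrE ?(ltW cp) // lerDl ltW.
  by rewrite -(ler_pM2l cp); nra.
move/le_trans; apply; rewrite /c mulrDl lerD2l -mulrA ler_piMr ?(ltW e0) //.
by rewrite mulrC ler_pdivrMr ?mul1r ?lerDl // ltr_wpDl.
Qed.

(** A column of [A] is the image of a unit vector. This bound makes truncation of the entries at
    [L k] harmless. *)
Lemma opnorm_entry A i j : `|Re (A i j)| <= opnorm A /\ `|Im (A i j)| <= opnorm A.
Proof.
apply: normr_le_sqr; first exact: opnorm_ge0.
have -> : A i j = (A *m (delta_mx j 0 : 'cV[C]_n)) i 0 by rewrite -colE mxE.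
apply: le_trans (rip_entry _ _) _; apply: le_trans (rip_mulmx_opnorm _ _) _.
rewrite ler_piMr ?sqr_ge0 //.
by rewrite -[X in rip _ X]mul1mx rip_delta mxE eqxx mulr1n.
Qed.

Lemma psd_scalar (c : R) : 0 <= c -> psd ((cR c)%:M : 'M[C]_n).
Proof.
move=> c0; split.
  apply/matrixP => i j; rewrite !mxE eq_sym; case: eqP => _; rewrite ?mulr1n ?mulr0n.
    by apply/eqP; rewrite eq_complex /= oppr0 !eqxx.
  by rewrite rmorph0.
move=> v; rewrite mul_mx_scalar -scalemxAl mxE mulr_ge0 ?ler0c //.
by rewrite mxE sumr_ge0 // => i _; rewrite !mxE mulrC mul_conjC_ge0.
Qed.

Lemma psdD A (B : 'M[C]_n) : psd A -> psd B -> psd (A + B).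
Proof.
move=> [aA pA] [aB pB]; split.
  by move: aA aB; rewrite /adjmx map_mxD linearD /= => -> ->.
by move=> v; rewrite mulmxDr mulmxDl mxE addr_ge0.
Qed.

Lemma psdZ A (c : R) : 0 <= c -> psd A -> psd (cR c *: A).
Proof.
move=> c0 [aA pA]; split.
  apply/matrixP => i j; rewrite -[in RHS]aA !mxE rmorphM /=.
  by congr (_ * _); apply/eqP; rewrite eq_complex /= oppr0 !eqxx.
by move=> v; rewrite -scalemxAr -scalemxAl mxE mulr_ge0 ?ler0c.
Qed.

Lemma psd_opnorm A c : psd A -> opnorm A <= c -> psd ((cR c)%:M - A).
Proof.
move=> hA Ac; have [aA pA] := hA.
have c0 : 0 <= c := le_trans (opnorm_ge0 A) Ac.
have [aI pI] := psd_scalar c0.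
split; first by rewrite adjmxB aA aI.
move=> v; rewrite mulmxBr mulmxBl mxE [X in _ + X]mxE subr_ge0 lecE.
rewrite (ger0_Im (pA v)) (ger0_Im (pI v)) eqxx /=.
rewrite mul_mx_scalar -scalemxAl [X in _ <= Re X]mxE Re_cRl -mulmxA.
by apply: le_trans (rip_le_opnorm A v) _; rewrite ler_wpM2r ?ripvv_ge0.
Qed.

Lemma opnorm_scalar (c : R) : (0 < n)%N -> 0 <= c -> opnorm ((cR c)%:M : 'M[C]_n) = c.
Proof.
move=> n0 c0; have hs v : rip ((cR c)%:M *m v) ((cR c)%:M *m v) = c ^+ 2 * rip v v.
  by rewrite mul_scalar_mx ripZl ripZr mulrA expr2.
apply/eqP; rewrite eq_le; apply/andP; split.
  apply: ge_sup; first by exists (vnorm ((cR c)%:M *m (0 : 'cV[C]_n))); exists 0 => //=;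
    rewrite vnorm_le // rip0 expr1n.
  move=> _ [v v1 <-]; rewrite vnorm_le // hs ler_piMr ?sqr_ge0 //.
  by move: v1; rewrite /= vnorm_le // expr1n.
have [h _] := opnorm_entry ((cR c)%:M : 'M[C]_n) (Ordinal n0) (Ordinal n0).
by apply: le_trans h; rewrite mxE eqxx mulr1n /= ler_norm.
Qed.

End OperatorNorm.

(** * Expectation and independence of bounded random variables *)

Local Open Scope classical_set_scope.
Local Open Scope ring_scope.

(** The bound holds at every point, which gives integrability and stability under sums and products
    with no exceptional sets. *)
Definition bounded_rv d (T : measurableType d) (R : realType) (f : T -> R) :=
  measurable_fun setT f /\ exists M, forall t, `|f t| <= M.

Section BoundedExpectation.
Context d (T : measurableType d) (R : realType) (P : probability T R).
Implicit Types f g : T -> R.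
Local Notation EX f := (Rintegral P setT f).

Lemma bounded_rv_cst (c : R) : bounded_rv (fun _ : T => c).
Proof. by split; [exact: measurable_cst|exists `|c|]. Qed.

Lemma bounded_rvD f g : bounded_rv f -> bounded_rv g ->
  bounded_rv (fun t => f t + g t).
Proof.
move=> [mf [M hM]] [mg [K hK]]; split; first exact: measurable_funD.
by exists (M + K) => t; apply: le_trans (ler_normD _ _) _; apply: lerD.
Qed.

Lemma bounded_rvM f g : bounded_rv f -> bounded_rv g ->
  bounded_rv (fun t => f t * g t).
Proof.
move=> [mf [M hM]] [mg [K hK]]; split; first exact: measurable_funM.
by exists (M * K) => t; rewrite normrM; apply: ler_pM.
Qed.

Lemma bounded_rv_integrable f : bounded_rv f -> P.-integrable setT (EFin \o f).
Proof.
move=> [mf [M hM]]; apply: measurable_bounded_integrable => //.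
  by rewrite (le_lt_trans (probability_le1 P _)) // ltry.
by exists M; split; [exact: num_real|move=> x Mx t _; apply: le_trans (hM t) (ltW Mx)].
Qed.

Lemma EXE f : bounded_rv f -> (\int[P]_t (f t)%:E)%E = (EX f)%:E.
Proof.
by move=> hf; rewrite fineK //; apply: integrable_fin_num => //;
  exact: bounded_rv_integrable.
Qed.

Lemma EXD f g : bounded_rv f -> bounded_rv g ->
  EX (fun t => f t + g t) = EX f + EX g.
Proof. by move=> hf hg; rewrite RintegralD //; exact: bounded_rv_integrable. Qed.

Lemma EXZ (c : R) f : bounded_rv f -> EX (fun t => c * f t) = c * EX f.
Proof. by move=> hf; rewrite RintegralZl //; exact: bounded_rv_integrable. Qed.

Lemma EX_cst (c : R) : EX (fun=> c) = c.
Proof.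
rewrite Rintegral_cst // [X in fine X](_ : _ = 1%E) ?mulr1 //.
exact: probability_setT.
Qed.

Lemma bounded_rv_sum I (r : seq I) (F : I -> T -> R) :
  (forall i, bounded_rv (F i)) -> bounded_rv (fun t => \sum_(i <- r) F i t).
Proof.
move=> hF; elim: r => [|i r IH].
  by under eq_fun do rewrite big_nil; exact: bounded_rv_cst.
by under eq_fun do rewrite big_cons; exact: bounded_rvD.
Qed.

Lemma EX_sum I (r : seq I) (F : I -> T -> R) :
  (forall i, bounded_rv (F i)) ->
  EX (fun t => \sum_(i <- r) F i t) = \sum_(i <- r) EX (F i).
Proof.
move=> hF; elim: r => [|i r IH].
  by under eq_fun do rewrite big_nil; rewrite big_nil EX_cst.
under eq_fun do rewrite big_cons.
by rewrite big_cons EXD ?IH //; exact: bounded_rv_sum.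
Qed.

Lemma ae_eq_EX f g : measurable_fun setT f -> measurable_fun setT g ->
  {ae P, forall t, f t = g t} -> EX f = EX g.
Proof.
move=> mf mg fg; congr fine; apply: ae_eq_integral => //; try exact/measurable_EFinP.
by apply: filterS fg => t fgt _; rewrite /= fgt.
Qed.

Lemma EX_ge0 f : bounded_rv f -> {ae P, forall t, 0 <= f t} -> 0 <= EX f.
Proof.
move=> [mf _] f0; rewrite (@ae_eq_EX f (fun t => Num.max (f t) 0)) //.
- by apply: Rintegral_ge0 => t _; rewrite le_max lexx orbT.
- exact: measurable_maxr.
- by apply: filterS f0 => t ft; rewrite max_l.
Qed.

Lemma EX_le f g : bounded_rv f -> bounded_rv g ->
  {ae P, forall t, f t <= g t} -> EX f <= EX g.
Proof.
move=> hf hg fg; have hNf : bounded_rv (fun t => -1 * f t).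
  by apply: bounded_rvM => //; exact: bounded_rv_cst.
rewrite -subr_ge0 -[- EX f]mulN1r -EXZ // -EXD //.
apply: EX_ge0; first exact: bounded_rvD.
by apply: filterS fg => t; rewrite mulN1r subr_ge0.
Qed.

(** By the product rule the law of the pair agrees with the product of the laws on rectangles, hence
    everywhere; the integral of x y against it is then computed by Fubini. *)
Lemma EX_indep f g : bounded_rv f -> bounded_rv g ->
  (forall A B, measurable A -> measurable B ->
    P (f @^-1` A `&` g @^-1` B) = (P (f @^-1` A) * P (g @^-1` B))%E) ->
  EX (fun t => f t * g t) = EX f * EX g.
Proof.
move=> hf hg indep; have [mf _] := hf; have [mg _] := hg.
pose U : {RV P >-> R} := mfun_Sub (mem_set mf : f \in mfun).
pose V : {RV P >-> R} := mfun_Sub (mem_set mg : g \in mfun).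
have mfg : measurable_fun setT (fun t => (f t, g t)) by exact: measurable_fun_pair.
pose W : {RV P >-> (R * R)%type} := mfun_Sub (mem_set mfg : _ \in mfun).
pose h (z : (R * R)%type) := (z.1 * z.2)%:E.
have mh : measurable_fun setT h.
  by apply/measurable_EFinP; apply: measurable_funM.
have ihW : P.-integrable setT (h \o W).
  by have := bounded_rv_integrable (bounded_rvM hf hg).
have prodE A : measurable A ->
    (distribution P U \x distribution P V)%E A = distribution P W A.
  apply: product_measure_unique => B C mB mC.
  by rewrite -indep.
apply: EFin_inj; rewrite -EXE; last exact: bounded_rvM.
transitivity (\int[distribution P W]_z h z)%E.
  by rewrite integral_distribution.
have ih : (distribution P U \x distribution P V)%E.-integrable setT h.
  have := integrable_pushforward mfg mh ihW measurableT.
  move=> /integrableP[_ fin]; apply/integrableP; split => //.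
  by rewrite (eq_measure_integral (distribution P W)) // => A mA _; exact: prodE.
rewrite (eq_measure_integral (distribution P U \x distribution P V)%E); last first.
  by move=> A mA _; apply/esym; exact: prodE.
rewrite -integral12_prod_meas1 //.
have EV x : fubini_F (distribution P V) h x = (x * EX g)%:E.
  rewrite /fubini_F /h /= integral_distribution /=.
  - by rewrite -EXZ // -EXE //; apply: bounded_rvM => //; exact: bounded_rv_cst.
  - by apply/measurable_EFinP; exact: measurable_funM.
  - by apply: bounded_rv_integrable; apply: bounded_rvM => //; exact: bounded_rv_cst.
under eq_integral do rewrite EV.
rewrite integral_distribution /=.
- rewrite mulrC -EXZ // -EXE; last by apply: bounded_rvM => //; exact: bounded_rv_cst.
  by apply: eq_integral => t _ /=; rewrite mulrC.
- by apply/measurable_EFinP; exact: measurable_funM.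
- by apply: bounded_rv_integrable; apply: bounded_rvM => //; exact: bounded_rv_cst.
Qed.

End BoundedExpectation.

(** * Independence of one member from the earlier ones *)

Section Grouping.
Context d (T : measurableType d) (R : realType) (P : probability T R) (N : nat).
Variable H : 'I_N -> set (set T).
Hypothesis mH : forall i, H i `<=` measurable.
Hypothesis indepH : indep_family P (fun i => <<s H i>>).

(* a pi-system generating the sigma-algebra of the first [m] members *)
Definition head_events (m : nat) : set (set T) :=
  [set E | exists A : 'I_N -> set T,
     [/\ forall i, <<s H i>> (A i), forall i : 'I_N, (m <= i)%N -> A i = setT &
         E = \bigcap_(i in [set: 'I_N]) A i]].

Lemma sigma_measurable i : <<s H i>> `<=` measurable.
Proof. exact: smallest_sub (@sigma_algebra_measurable _ T) (@mH i). Qed.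

Lemma sigma_setT i : <<s H i>> [set: T].
Proof. exact: (@measurableT _ (g_sigma_algebraType (H i))). Qed.

Lemma sigma_setI i A B : <<s H i>> A -> <<s H i>> B -> <<s H i>> (A `&` B).
Proof. exact: (@measurableI _ (g_sigma_algebraType (H i))). Qed.

Lemma head_events_measurable m : head_events m `<=` measurable.
Proof.
move=> E [A [hA _ ->]]; apply: fin_bigcap_measurable => [|i _]; first exact: finite_finset.
exact: sigma_measurable (hA i).
Qed.

Lemma head_events_setI m : setI_closed (head_events m).
Proof.
move=> E F [A [hA AT ->]] [B [hB BT ->]]; exists (fun i => A i `&` B i); split.
- by move=> i; exact: sigma_setI.
- by move=> i mi; rewrite AT // BT // setIT.
- by rewrite bigcapI.
Qed.

Lemma head_events_setT m : head_events m [set: T].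
Proof.
exists (fun=> setT); split=> //; first by move=> i; exact: sigma_setT.
by rewrite bigcapT.
Qed.

Lemma head_events_sub m (i : 'I_N) : (i < m)%N -> <<s H i>> `<=` head_events m.
Proof.
move=> im A hA; exists (fun j => if j == i then A else setT); split.
- by move=> j; case: eqP => [->//|_]; exact: sigma_setT.
- by move=> j mj; case: eqP => // ji; move: im; rewrite -ji ltnNge mj.
- apply/seteqP; split=> [t At j _ /=|t /(_ i I)]; first by case: eqP.
  by rewrite /= eqxx.
Qed.

(** Both sides are finite measures in [E] that agree on the pi-system of head events, hence on the
    sigma-algebra it generates. *)
Lemma head_indep (k : 'I_N) (B E : set T) : <<s H k>> B ->
  <<s head_events k>> E -> P (E `&` B) = (P E * P B)%E.
Proof.
move=> hB hE; have mB := sigma_measurable hB.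
have PB0 : 0 <= fine (P B) by apply: fine_ge0.
have PBE : P B = (fine (P B))%:E by rewrite fineK // fin_num_measure.
pose m1 := mrestr P mB.
pose m2 := mscale (NngNum PB0) P.
rewrite muleC PBE.
change (m1 E = m2 E).
apply: (g_sigma_algebra_measure_unique (head_events k)
  (@head_events_measurable k) (fun=> setT)) => //.
- by move=> _; exact: head_events_setT.
- by apply/seteqP; split => // t _; exists 0%N.
- exact: head_events_setI.
- move=> F [A [hA AT ->]]; change (P (\bigcap_(i in [set: 'I_N]) A i `&` B)
    = (fine (P B))%:E * P (\bigcap_(i in [set: 'I_N]) A i))%E; rewrite -PBE.
  (* The k-th component of a head event is the whole space, so it can be replaced by [B] and the
     product rule applied to the full family. *)
  pose A' i := if i == k then B else A i.
  have hA' i : <<s H i>> (A' i) by rewrite /A'; case: eqP => [->|].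
  have -> : \bigcap_(i in [set: 'I_N]) A i `&` B = \bigcap_(i in [set: 'I_N]) A' i.
    apply/seteqP; split=> [t [At Bt] i _|t At]; rewrite /A'.
      by case: eqP => // _; exact: At.
    split; last by have := At k I; rewrite /A' eqxx.
    move=> i _; have := At i I; rewrite /A'; case: eqP => // -> _.
    by rewrite AT.
  rewrite !indepH // (bigD1 k) //= {1}/A' eqxx [in RHS](bigD1 k) //= AT //.
  rewrite probability_setT mul1e; congr (_ * _)%E.
  by apply: eq_bigr => i /negbTE ik; rewrite /A' ik.
- by move=> _; rewrite /m1 /mrestr (le_lt_trans (probability_le1 P _)) ?ltry //;
    exact: measurableI.
Qed.

Lemma EX_head (k : 'I_N) f g : bounded_rv f -> bounded_rv g ->
  (forall B, measurable B -> <<s head_events k>> (f @^-1` B)) ->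
  (forall B, measurable B -> <<s H k>> (g @^-1` B)) ->
  Rintegral P setT (fun t => f t * g t)
  = Rintegral P setT f * Rintegral P setT g.
Proof.
by move=> hf hg sf sg; apply: EX_indep => // A B mA mB;
  apply: head_indep; [exact: sg|exact: sf].
Qed.

End Grouping.

(** * Replacing one random matrix *)

Section FunctionAlgebra.
Variables (T : Type) (R : realType) (n : nat) (Q : (T -> R) -> Prop).
Local Notation C := (complex.complex R).
Local Notation Re := (@complex.Re R).
Local Notation Im := (@complex.Im R).
Implicit Types W V : T -> 'M[C]_n.

(** Entries of polynomials in random matrices arise by sums and products. The closure lemmas are
    proved once and used for measurable functions, bounded variables, and bounded variables
    measurable for a smaller sigma-algebra. *)
Definition function_algebra :=
  [/\ forall c, Q (fun=> c),
      forall f g, Q f -> Q g -> Q (fun t => f t + g t) &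
      forall f g, Q f -> Q g -> Q (fun t => f t * g t)].

Hypothesis hQ : function_algebra.

Definition mx_in W :=
  forall i j, Q (fun t => Re (W t i j)) /\ Q (fun t => Im (W t i j)).

Lemma algN f : Q f -> Q (fun t => - f t).
Proof.
case: hQ => Qc _ QM Qf; under eq_fun do rewrite -mulN1r.
exact: QM (Qc _) Qf.
Qed.

Lemma algX f p : Q f -> Q (fun t => f t ^+ p).
Proof.
case: hQ => Qc _ QM Qf; elim: p => [|p IH].
  by under eq_fun do rewrite expr0; exact: Qc.
by under eq_fun do rewrite exprS; exact: QM.
Qed.

Lemma alg_sum I (r : seq I) (p : pred I) (F : I -> T -> R) :
  (forall i, Q (F i)) -> Q (fun t => \sum_(i <- r | p i) F i t).
Proof.
case: hQ => Qc QD _ QF; elim: r => [|i r IH].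
  by under eq_fun do rewrite big_nil; exact: Qc.
under eq_fun do rewrite big_cons.
by case: (p i) => //; exact: QD.
Qed.

Lemma mx_in_cst (A : 'M[C]_n) : mx_in (fun=> A).
Proof. by case: hQ => Qc _ _ i j. Qed.

Lemma mx_inD W V : mx_in W -> mx_in V -> mx_in (fun t => W t + V t).
Proof.
case: hQ => _ QD _ hW hV i j; have [W1 W2] := hW i j; have [V1 V2] := hV i j.
by split; under eq_fun do rewrite mxE ?(Re_add, Im_add); exact: QD.
Qed.

Lemma mx_inM W V : mx_in W -> mx_in V -> mx_in (fun t => W t *m V t).
Proof.
case: hQ => _ QD QM hW hV i j; split;
  under eq_fun do rewrite mxE ?(Re_sum, Im_sum); apply: alg_sum => l;
  have [W1 W2] := hW i l; have [V1 V2] := hV l j.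
  under eq_fun do rewrite Re_mul; apply: QD; first exact: QM.
  by apply: algN; exact: QM.
by under eq_fun do rewrite Im_mul; apply: QD; exact: QM.
Qed.

Lemma mx_inX W p : mx_in W -> mx_in (fun t => W t ^+ p).
Proof.
move=> hW; elim: p => [|p IH]; first exact: mx_in_cst.
by under eq_fun do rewrite exprS; exact: mx_inM.
Qed.

Lemma mx_in_sum I (r : seq I) (p : pred I) (F : I -> T -> 'M[C]_n) :
  (forall i, mx_in (F i)) -> mx_in (fun t => \sum_(i <- r | p i) F i t).
Proof.
move=> QF; elim: r => [|i r IH].
  by under eq_fun do rewrite big_nil; exact: mx_in_cst.
under eq_fun do rewrite big_cons.
by case: (p i) => //; exact: mx_inD.
Qed.

Lemma alg_rtr W : mx_in W -> Q (fun t => rtr (W t)).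
Proof.
move=> hW; under eq_fun do rewrite rtrE.
by apply: alg_sum => i; have [] := hW i i.
Qed.

End FunctionAlgebra.

Lemma mx_in_sub (T : Type) (R : realType) n (Q Q' : (T -> R) -> Prop)
    (W : T -> 'M[complex.complex R]_n) :
  (forall f, Q f -> Q' f) -> mx_in Q W -> mx_in Q' W.
Proof. by move=> QQ hW i j; have [? ?] := hW i j; split; exact: QQ. Qed.

Section Algebras.
Context d (T : measurableType d) (R : realType).

Lemma measurable_algebra :
  function_algebra (fun f : T -> R => measurable_fun setT f).
Proof.
split=> [c|f g|f g]; [exact: measurable_cst|exact: measurable_funD|].
exact: measurable_funM.
Qed.

Lemma bounded_algebra : function_algebra (fun f : T -> R => bounded_rv f).
Proof.
split=> [c|f g|f g]; [exact: bounded_rv_cst|exact: bounded_rvD|].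
exact: bounded_rvM.
Qed.

Definition sub_rv (F : set (set T)) (f : T -> R) :=
  bounded_rv f /\ forall B, measurable B -> <<s F>> (f @^-1` B).

Lemma sub_rv_measurable F (f : T -> R) :
  (forall B, measurable B -> <<s F>> (f @^-1` B)) <->
  measurable_fun [set: g_sigma_algebraType F] f.
Proof.
split=> [h _ B mB|h B mB]; first by rewrite setTI; exact: h.
by have := h measurableT B mB; rewrite setTI.
Qed.

Lemma sub_algebra F : function_algebra (sub_rv F).
Proof.
split=> [c|f g [bf mf] [bg mg]|f g [bf mf] [bg mg]].
- by split; [exact: bounded_rv_cst|apply/sub_rv_measurable; exact: measurable_cst].
- split; [exact: bounded_rvD|apply/sub_rv_measurable].
  by apply: measurable_funD; exact/sub_rv_measurable.
- split; [exact: bounded_rvM|apply/sub_rv_measurable].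
  by apply: measurable_funM; exact/sub_rv_measurable.
Qed.

End Algebras.

(** The arithmetic that ends [replacement]: x_i and g_i are the expectations of tr A_i and tr (E Y)
    A_i, where A_0 and A_1 are the powers with shifts c and c + l. *)
Lemma mixture_bound (R : realType) (l a x0 x1 g0 g1 : R) : 0 < l ->
  0 <= (a * l * x1 + - (a * l) * x0) + (- 1 * g1 + g0) ->
  x0 + l^-1 * (g1 + - 1 * g0) <= (1 - a) * x0 + a * x1.
Proof.
move=> l0 h; have {}h : g1 - g0 <= l * (a * (x1 - x0)) by lra.
have : l^-1 * (g1 - g0) <= a * (x1 - x0) by rewrite mulrC ler_pdivrMr // mulrC.
lra.
Qed.

Section Replacement.
Context d (T : measurableType d) (R : realType) (P : probability T R) (n : nat).
Local Notation C := (complex.complex R).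
Local Notation Re := (@complex.Re R).
Local Notation Im := (@complex.Im R).
Local Notation EX f := (Rintegral P setT f).
Local Notation bmx := (mx_in (fun f : T -> R => bounded_rv f)).
Implicit Types W Y M : T -> 'M[C]_n.

Lemma rtr_mulE (A B : 'M[C]_n) : rtr (A *m B) =
  \sum_i \sum_j (Re (A i j) * Re (B j i) + - 1 * (Im (A i j) * Im (B j i))).
Proof.
rewrite rtrE; apply: eq_bigr => i _; rewrite mxE Re_sum.
by apply: eq_bigr => j _; rewrite Re_mul mulN1r.
Qed.

(** Re tr (Y M) only contains products of two real or of two imaginary parts, so the product rule is
    asked for these pairs alone. *)
Lemma EX_rtr_mul Y M : bmx Y -> bmx M ->
  (forall i j, [/\
     EX (fun t => Re (Y t i j) * Re (M t j i)) =
       EX (fun t => Re (Y t i j)) * EX (fun t => Re (M t j i)) &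
     EX (fun t => Im (Y t i j) * Im (M t j i)) =
       EX (fun t => Im (Y t i j)) * EX (fun t => Im (M t j i))]) ->
  EX (fun t => rtr (Y t *m M t)) = EX (fun t => rtr (Emx P Y *m M t)).
Proof.
move=> hY hM indep.
have main Z : bmx Z -> EX (fun t => rtr (Z t *m M t)) =
    \sum_i \sum_j (EX (fun t => Re (Z t i j) * Re (M t j i))
                    + - 1 * EX (fun t => Im (Z t i j) * Im (M t j i))).
  move=> hZ; under eq_fun do rewrite rtr_mulE.
  have b1 i j : bounded_rv (fun t => Re (Z t i j) * Re (M t j i)).
    by have [? _] := hZ i j; have [? _] := hM j i; exact: bounded_rvM.
  have b2 i j : bounded_rv (fun t => Im (Z t i j) * Im (M t j i)).
    by have [_ ?] := hZ i j; have [_ ?] := hM j i; exact: bounded_rvM.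
  have b3 i j : bounded_rv (fun t => - 1 * (Im (Z t i j) * Im (M t j i))).
    by apply: bounded_rvM; [exact: bounded_rv_cst|].
  rewrite EX_sum => [|i]; last by apply: bounded_rv_sum => j; exact: bounded_rvD.
  apply: eq_bigr => i _; rewrite EX_sum => [|j]; last exact: bounded_rvD.
  by apply: eq_bigr => j _; rewrite EXD // EXZ.
rewrite !main //; last by exact: (mx_in_cst (bounded_algebra T R)).
apply: eq_bigr => i _; apply: eq_bigr => j _.
have [-> ->] := indep i j; have [? ?] := hM j i.
by congr (_ + _ * _); rewrite EXZ // mxE.
Qed.

(** The deterministic inequality is applied to A = W + c and X = Y / l. In its expectation
    independence replaces [Y] by its mean, which is then bounded by a l. *)
Lemma replacement W Y (c l a : R) p :
  bmx W -> bmx Y -> 0 < l -> 0 <= c ->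
  {ae P, forall t, psd (W t)} ->
  {ae P, forall t, psd (Y t) /\ psd ((cR l)%:M - Y t)} ->
  psd ((cR (a * l))%:M - Emx P Y) ->
  (forall q c', EX (fun t => rtr (Y t *m (W t + (cR c')%:M) ^+ q)) =
       EX (fun t => rtr (Emx P Y *m (W t + (cR c')%:M) ^+ q))) ->
  EX (fun t => rtr ((W t + Y t + (cR c)%:M) ^+ p)) <=
  (1 - a) * EX (fun t => rtr ((W t + (cR c)%:M) ^+ p)) +
  a * EX (fun t => rtr ((W t + (cR (c + l))%:M) ^+ p)).
Proof.
move=> hW hY l0 c0 psdW psdY psdE indep.
have bA := bounded_algebra T R.
have bWc c' q : bmx (fun t => (W t + (cR c')%:M) ^+ q).
  by apply: mx_inX => //; apply: mx_inD => //; exact: (mx_in_cst bA).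
have brtr (V : T -> 'M[C]_n) : bmx V -> bounded_rv (fun t => rtr (V t)) by exact: (alg_rtr bA).
pose A0 t := (W t + (cR c)%:M) ^+ p; pose A1 t := (W t + (cR (c + l))%:M) ^+ p.
have bA0 : bmx A0 by exact: bWc.
have bA1 : bmx A1 by exact: bWc.
have Ec (B : 'M[C]_n) : bmx (fun=> B) by exact: (mx_in_cst bA).
have rtrN (B : 'M[C]_n) : rtr (- B) = - rtr B.
  by rewrite /rtr linearN Re_opp.
have linv : cR l^-1 * cR l = 1 :> C by rewrite -cRM mulVf ?gt_eqF.
have bEY V : bmx V -> bounded_rv (fun t => rtr (Emx P Y *m V t)).
  by move=> hV; apply: (brtr); exact: (mx_inM bA).
have bY V : bmx V -> bounded_rv (fun t => rtr (Y t *m V t)).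
  by move=> hV; apply: (brtr); exact: (mx_inM bA).
have bZ (r : R) (f : T -> R) : bounded_rv f ->
    bounded_rv (fun t => r * f t) by apply: bounded_rvM; exact: bounded_rv_cst.
have H1 : {ae P, forall t, rtr ((W t + Y t + (cR c)%:M) ^+ p) <=
    rtr (A0 t) + l^-1 * (rtr (Y t *m A1 t) + - 1 * rtr (Y t *m A0 t))}.
  apply: filterS2 psdW psdY => t Wt [Yt lYt].
  have hA : psd (W t + (cR c)%:M) by exact: (psdD Wt (psd_scalar n c0)).
  have hX : psd (cR l^-1 *: Y t) by apply: psdZ => //; rewrite invr_ge0 ltW.
  have hX1 : psd (1%:M - cR l^-1 *: Y t).
    have -> : 1%:M - cR l^-1 *: Y t = cR l^-1 *: ((cR l)%:M - Y t).
      by rewrite scalerBr scale_scalar_mx linv.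
    by apply: psdZ => //; rewrite invr_ge0 ltW.
  have := rtr_pow_le hA hX (ltW l0) p hX1.
  rewrite scalerA mulrC -cRM mulVf ?gt_eqF // scale1r addrAC => /le_trans; apply.
  rewrite lerD2l -scalemxAl rtrZ -addrA -raddfD -cRD mulmxBr rtrD rtrN mulN1r.
  by [].
(* Positivity of a l - E Y, paired with the increment of the power. *)
have H2 : {ae P, forall t, 0 <= (a * l * rtr (A1 t) + - (a * l) * rtr (A0 t))
    + (- 1 * rtr (Emx P Y *m A1 t) + rtr (Emx P Y *m A0 t))}.
  apply: filterS psdW => t Wt.
  have hA : psd (W t + (cR c)%:M) by exact: (psdD Wt (psd_scalar n c0)).
  have := rtr_pow_incr_ge0 hA psdE (ltW l0) p.
  rewrite -addrA -raddfD -cRD -/(A0 t) -/(A1 t) mulmxBl rtrD mul_scalar_mx rtrZ.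
  clearbody A0 A1; rewrite !mulmxBr !rtrD !rtrN rtrD rtrN.
  move: (rtr (A0 t)) (rtr (A1 t)) (rtr (_ *m A0 t)) (rtr (_ *m A1 t)) => x y z w.
  by lra.
have indep0 : EX (fun t => rtr (Y t *m A0 t)) = EX (fun t => rtr (Emx P Y *m A0 t)).
  exact: indep.
have indep1 : EX (fun t => rtr (Y t *m A1 t)) = EX (fun t => rtr (Emx P Y *m A1 t)).
  exact: indep.
have bV : bounded_rv (fun t => rtr ((W t + Y t + (cR c)%:M) ^+ p)).
  exact: (brtr _ (mx_inX bA p (mx_inD bA (mx_inD bA hW hY) (Ec (cR c)%:M)))).
change (EX (fun t => rtr ((W t + Y t + (cR c)%:M) ^+ p)) <=
  (1 - a) * EX (fun t => rtr (A0 t)) + a * EX (fun t => rtr (A1 t))).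
clearbody A0 A1.
have cA0 := brtr _ bA0; have cA1 := brtr _ bA1.
have cY0 := bY _ bA0; have cY1 := bY _ bA1.
have cE0 := bEY _ bA0; have cE1 := bEY _ bA1.
have d0 := bZ (- 1) _ cY0; have d1 := bounded_rvD cY1 d0.
have d2 := bZ l^-1 _ d1.
have step1 := EX_le bV (bounded_rvD cA0 d2) H1.
rewrite (EXD P cA0 d2) (EXZ P _ d1) (EXD P cY1 d0) (EXZ P _ cY0) indep0 indep1 in step1.
have e0 := bZ (- (a * l)) _ cA0; have e1 := bZ (a * l) _ cA1.
have e2 := bZ (- 1) _ cE1.
have step2 := EX_ge0 (bounded_rvD (bounded_rvD e1 e0) (bounded_rvD e2 cE0)) H2.
rewrite (EXD P (bounded_rvD e1 e0) (bounded_rvD e2 cE0)) (EXD P e1 e0) in step2.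
rewrite (EXD P e2 cE0) (EXZ P _ cA0) (EXZ P _ cA1) (EXZ P _ cE1) in step2.
apply: le_trans step1 _.
exact: mixture_bound.
Qed.
End Replacement.

(** * Truncation and the recursion for the random matrices *)

Section Clip.
Variable R : realType.

Definition clip (c x : R) : R := Num.max (- c) (Num.min c x).

Lemma measurable_clip c : measurable_fun setT (clip c).
Proof.
apply: measurable_maxr; first exact: measurable_cst.
by apply: measurable_minr; first exact: measurable_cst.
Qed.

Lemma clip_bound c x : 0 <= c -> `|clip c x| <= c.
Proof.
move=> c0; rewrite ler_norml /clip le_max lexx ge_max /=.
by rewrite ge_min lexx andbT; lra.
Qed.

Lemma clip_id c x : `|x| <= c -> clip c x = x.
Proof. by rewrite ler_norml => /andP[h1 h2]; rewrite /clip min_r // max_r. Qed.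

End Clip.

Lemma head_sumS (V : nmodType) N (F : 'I_N -> V) (k : 'I_N) :
  \sum_(i < N | (i < k.+1)%N) F i = \sum_(i < N | (i < k)%N) F i + F k.
Proof.
rewrite (bigD1 k) //= addrC; congr (_ + _); apply: eq_bigl => i.
by rewrite ltnS [in RHS]ltn_neqAle andbC.
Qed.

Lemma sub_rv_head (R : realType) d (T : measurableType d) N
    (H : 'I_N -> set (set T)) m (i : 'I_N) (f : T -> R) : (i < m)%N ->
  sub_rv (H i) f -> sub_rv (head_events H m) f.
Proof.
move=> im [bf mf]; split=> // B mB.
by apply: sub_sigma_algebra; apply: (head_events_sub im); exact: mf.
Qed.

Section MatrixSide.
Context d (T : measurableType d) (R : realType) (P : probability T R) (n N : nat).
Local Notation C := (complex.complex R).
Local Notation Re := (@complex.Re R).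
Local Notation Im := (@complex.Im R).
Local Notation EX f := (Rintegral P setT f).
Variables (L alpha : 'I_N -> R) (X : 'I_N -> T -> 'M[C]_n).
Hypothesis hL : forall k, 0 < L k.
Hypothesis hX : admissible P L alpha X.

(* truncating the entries makes the variables bounded everywhere, and
   changes each X k only on a null set *)
Definition clipmx k t : 'M[C]_n :=
  \matrix_(i, j) complex.Complex (clip (L k) (Re (X k t i j)))
                                 (clip (L k) (Im (X k t i j))).

(** The generators of [mx_sigma (X k)], repeated so that independence holds by conversion. They come
    from the original entries; preimages under truncated entries are again of this form. *)
Definition entry_events k : set (set T) :=
  [set A : set T | exists (i j : 'I_n) (B : set R), measurable B /\
          (A = (fun t => Re (X k t i j)) @^-1` B \/
           A = (fun t => Im (X k t i j)) @^-1` B)].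

Lemma entry_events_measurable k : entry_events k `<=` measurable.
Proof.
case: hX => mX _ _ _ _ A [i [j [B [mB AE]]]]; have [m1 m2] := mX k i j.
case: AE => ->; rewrite -[X in measurable X]setTI; [exact: m1|exact: m2].
Qed.

Lemma indep_entries : indep_family P (fun k => <<s entry_events k>>).
Proof. by case: hX. Qed.

Lemma clipmx_in k : mx_in (sub_rv (entry_events k)) (clipmx k).
Proof.
case: hX => mX _ _ _ _ i j; have [m1 m2] := mX k i j.
have bclip (h : T -> R) : measurable_fun setT h ->
    bounded_rv (fun t => clip (L k) (h t)).
  move=> mh; split.
    exact: (measurableT_comp (measurable_clip (L k)) mh).
  by exists (L k) => t; apply: clip_bound; exact: ltW.
have mclip B : measurable B -> measurable (clip (L k) @^-1` B).
  by move=> mB; rewrite -[X in measurable X]setTI; exact: measurable_clip.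
split; under eq_fun do rewrite mxE /=; split; try exact: bclip.
  move=> B mB; apply: sub_sigma_algebra.
  by exists i, j, (clip (L k) @^-1` B); split; [exact: mclip|left].
move=> B mB; apply: sub_sigma_algebra.
by exists i, j, (clip (L k) @^-1` B); split; [exact: mclip|right].
Qed.

Lemma clipmx_ae : {ae P, forall t, forall k, clipmx k t = X k t}.
Proof.
case: hX => _ _ _ hb _; apply: filter_forall => k; apply: filterS (hb k) => t ht.
apply/matrixP => i j; rewrite mxE.
have [h1 h2] := opnorm_entry (X k t) i j.
rewrite !clip_id ?(le_trans h1) ?(le_trans h2) //.
by case: (X k t i j).
Qed.

Lemma clipmx_psd : {ae P, forall t, forall k,
  psd (clipmx k t) /\ psd ((cR (L k))%:M - clipmx k t)}.
Proof.
case: hX => _ _ hp hb _.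
have hpb : {ae P, forall t, forall k, psd (X k t) /\ opnorm (X k t) <= L k}.
  by apply: filter_forall => k; apply: filterS2 (hp k) (hb k) => t; exact: conj.
apply: filterS2 clipmx_ae hpb => t Et ht k; rewrite Et; have [h1 h2] := ht k.
by split; [exact: h1|exact: psd_opnorm].
Qed.

Lemma Emx_clipmx k : Emx P (clipmx k) = Emx P (X k).
Proof.
case: hX => mX _ _ _ _; apply/matrixP => i j; rewrite !mxE.
have [m1 m2] := mX k i j; have [[[n1 _] _] [[n2 _] _]] := clipmx_in k i j.
by congr complex.Complex; apply: ae_eq_EX => //; apply: filterS clipmx_ae => t ->.
Qed.

Lemma psd0 : psd (0 : 'M[C]_n).
Proof.
split; first by apply/matrixP => i j; rewrite !mxE rmorph0.
by move=> v; rewrite mulmx0 mul0mx mxE.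
Qed.

Lemma psd_sum I (r : seq I) (p : pred I) (F : I -> 'M[C]_n) :
  (forall i, psd (F i)) -> psd (\sum_(i <- r | p i) F i).
Proof.
move=> hF; elim/big_ind: _ => [|A B hA hB|i _]; [exact: psd0|exact: psdD|exact: hF].
Qed.

Definition headmx m t := \sum_(i < N | (i < m)%N) clipmx i t.

Lemma headmx_in m : mx_in (sub_rv (head_events entry_events m)) (headmx m).
Proof.
(* The cutoff moves inside the sum because only the members below [m] are measurable for the head
   events; the others become 0. *)
have -> : headmx m = fun t => \sum_(i < N) if (i < m)%N then clipmx i t else 0.
  by apply: funext => t; rewrite /headmx big_mkcond.
have aH := sub_algebra R (head_events entry_events m).
apply: (mx_in_sum aH) => i; case im: (i < m)%N.
  apply: (@mx_in_sub _ _ _ (sub_rv (entry_events i))) => [f|].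
    exact: sub_rv_head.
  exact: clipmx_in.
exact: (mx_in_cst aH).
Qed.

Lemma sub_bounded F (W : T -> 'M[C]_n) : mx_in (sub_rv F) W ->
  mx_in (fun f : T -> R => bounded_rv f) W.
Proof. by apply: mx_in_sub => f []. Qed.

(** The quadratic form at [v] is the trace against [v *m adjmx v], and expectation passes through it
    as through a product with an independent factor, here a constant. *)
Lemma psd_EX (W : T -> 'M[C]_n) : mx_in (fun f : T -> R => bounded_rv f) W ->
  {ae P, forall t, psd (W t)} -> psd (Emx P W).
Proof.
move=> hW psdW.
have herm : adjmx (Emx P W) = Emx P W.
  apply/matrixP => i j; rewrite !mxE; have [r1 i1] := hW j i; have [r2 i2] := hW i j.
  have entryE t : psd (W t) -> Re (W t j i) = Re (W t i j) /\
      -1 * Im (W t j i) = Im (W t i j).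
    by move=> [/matrixP/(_ i j)]; rewrite !mxE => <- _; case: (W t j i) => a b /=;
      rewrite mulN1r.
  rewrite [LHS](_ : _ = complex.Complex (EX (fun t => Re (W t j i)))
      (-1 * EX (fun t => Im (W t j i)))); last by rewrite mulN1r.
  have [m1 _] := r1; have [m2 _] := r2; have [m4 _] := i2.
  have [m3 _] := bounded_rvM (bounded_rv_cst T (-1)) i1.
  rewrite -EXZ //; congr complex.Complex; apply: ae_eq_EX => //;
    by apply: filterS psdW => t /entryE[].
split=> // v; set A := Emx P W in herm *.
have im0 : Im ((adjmx v *m A *m v) 0 0) = 0.
  have : adjmx (adjmx v *m A *m v) = adjmx v *m A *m v.
    by rewrite !adjmxM adjmxK herm mulmxA.
  move: (adjmx v *m A *m v) => B /matrixP/(_ 0 0); rewrite !mxE.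
  by case: (B 0 0) => a b [] /eqP; rewrite eqNr => /eqP.
rewrite lecE im0 eqxx /=.
have qfE (B : 'M[C]_n) : Re ((adjmx v *m B *m v) 0 0) = rtr (B *m (v *m adjmx v)).
  by rewrite /rtr (mulmxA B) mxtrace_mulC mulmxA trace_mx11.
rewrite qfE -(EX_cst P (rtr _)).
have bA := bounded_algebra T R.
have bM := mx_in_cst bA (v *m adjmx v).
rewrite -(EX_rtr_mul (M := fun=> v *m adjmx v)) //; last first.
  move=> i j; have [? ?] := hW i j.
  by split; under eq_Rintegral do rewrite mulrC; rewrite EXZ // EX_cst mulrC.
apply: EX_ge0; first by apply: (alg_rtr bA); exact: (mx_inM bA).
apply: filterS psdW => t ht; rewrite -qfE.
by have [_ /(_ v)] := ht; rewrite lecE => /andP[].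
Qed.

(** The first k matrices are measurable for the head events, hence independent of the next one, so
    [replacement] applies. *)
Lemma headmx_step (k : 'I_N) (c : R) p : 0 <= c ->
  EX (fun t => rtr ((headmx k.+1 t + (cR c)%:M) ^+ p)) <=
  (1 - alpha k) * EX (fun t => rtr ((headmx k t + (cR c)%:M) ^+ p)) +
  alpha k * EX (fun t => rtr ((headmx k t + (cR (c + L k))%:M) ^+ p)).
Proof.
move=> c0; have bh := headmx_in k; have bc := clipmx_in k.
have bY := sub_bounded bc.
have -> : headmx k.+1 = fun t => headmx k t + clipmx k t.
  by apply: funext => t; rewrite /headmx head_sumS.
apply: (@replacement _ T R P n (headmx k) (clipmx k) c (L k) (alpha k) p).
- exact: sub_bounded bh.
- exact: bY.
- exact: hL.
- exact: c0.
- by apply: filterS clipmx_psd => t ht; apply: psd_sum => i; case: (ht i).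
- by apply: filterS clipmx_psd => t /(_ k).
- apply: psd_opnorm; last by rewrite Emx_clipmx; case: hX => _ _ _ _ ->.
  by apply: psd_EX => //; apply: filterS clipmx_psd => t /(_ k)[].
move=> q c'; have aH := sub_algebra R (head_events entry_events k).
have bM : mx_in (sub_rv (head_events entry_events k))
    (fun t => (headmx k t + (cR c')%:M) ^+ q).
  by exact: (mx_inX aH q (mx_inD aH bh (mx_in_cst aH _))).
apply: EX_rtr_mul => [||i j]; [exact: bY|exact: sub_bounded bM|].
have [[b1 s1] [b2 s2]] := bc i j; have [[b3 s3] [b4 s4]] := bM j i.
have EXh := EX_head entry_events_measurable indep_entries.
by split; under eq_Rintegral do rewrite mulrC; rewrite (EXh k) // mulrC.
Qed.

End MatrixSide.

(** * The recursion for the Bernoulli family *)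

Section BernoulliSide.
Context d (T : measurableType d) (R : realType) (P : probability T R) (N : nat).
Local Notation EX f := (Rintegral P setT f).
Variables (L alpha : 'I_N -> R) (f : 'I_N -> T -> R).
Hypothesis hL : forall k, 0 < L k.
Hypothesis hfmeas : forall k, measurable_fun setT (f k).
Hypothesis hfind : indep_family P (fun k => rv_sigma (f k)).
Hypothesis hfL : forall k, P (f k @^-1` [set L k]) = (alpha k)%:E.
Hypothesis hf0 : forall k, P (f k @^-1` [set 0]) = (1 - alpha k)%:E.

Definition preimage_events k : set (set T) :=
  [set f k @^-1` B | B in (@measurable _ R)].

Lemma preimage_measurable k B : measurable B -> measurable (f k @^-1` B).
Proof. by move=> mB; rewrite -[X in measurable X]setTI; exact: hfmeas. Qed.

Lemma preimage_events_measurable k : preimage_events k `<=` measurable.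
Proof. by move=> _ [B mB <-]; exact: preimage_measurable. Qed.

(** A version of f k / L k that takes only the values 0 and 1 everywhere, whereas [f k] is
    two-valued only almost surely. *)
Definition hit k t : R := (f k t == L k)%:R.

Lemma hitE k : hit k = \1_(f k @^-1` [set L k]).
Proof.
apply: funext => t; rewrite indicE /hit; congr (nat_of_bool _)%:R.
by apply/eqP/idP => [h|]; rewrite inE.
Qed.

Lemma hit_in k : sub_rv (preimage_events k) (hit k).
Proof.
split.
  split; last by exists 1 => t; rewrite /hit normr_nat lern1 leq_b1.
  by rewrite hitE; apply: measurable_indic; exact: preimage_measurable.
move=> B mB; apply: sub_sigma_algebra.
exists ((\1_[set L k] : R -> R) @^-1` B); last first.
  apply/seteqP; split=> t; rewrite /preimage /= indicE /hit.
    by rewrite (_ : (f k t \in [set L k]) = (f k t == L k)) //;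
      apply/idP/eqP; rewrite inE.
  by rewrite (_ : (f k t \in [set L k]) = (f k t == L k)) //;
    apply/idP/eqP; rewrite inE.
by rewrite -[X in measurable X]setTI; exact: measurable_indic.
Qed.

Lemma EX_hit k : EX (hit k) = alpha k.
Proof.
rewrite hitE /Rintegral integral_indic //; last exact: preimage_measurable.
by rewrite setIT; exact: (congr1 fine (hfL k)).
Qed.

(** The events f k = L k and f k = 0 are disjoint since L k > 0, and their probabilities add up to
    1. *)
Lemma f_hit_ae : {ae P, forall t, forall k, f k t = L k * hit k t}.
Proof.
apply: filter_forall => k; pose A := f k @^-1` [set L k] `|` f k @^-1` [set 0].
have mA : measurable A by apply: measurableU; exact: preimage_measurable.
have PA : P A = 1%E.
  transitivity ((alpha k)%:E + (1 - alpha k)%:E)%E.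
    rewrite /A measureU; try exact: preimage_measurable.
      by congr (_ + _)%E; [exact: hfL|exact: hf0].
    apply/seteqP; split=> // t [/= -> h].
    by have := hL k; rewrite h ltxx.
  by rewrite -EFinD addrC subrK.
exists (~` A); split; first exact: measurableC.
  by rewrite probability_setC // PA subee.
move=> t /= nh [] /= ft; apply: nh; rewrite /hit ft ?eqxx ?mulr1 //.
by rewrite lt_eqF ?mulr0.
Qed.

Definition headsum m t : R := \sum_(i < N | (i < m)%N) L i * hit i t.

Lemma headsum_in m : sub_rv (head_events preimage_events m) (headsum m).
Proof.
have aH := sub_algebra R (head_events preimage_events m).
have -> : headsum m = fun t => \sum_(i < N) if (i < m)%N then L i * hit i t else 0.
  by apply: funext => t; rewrite /headsum big_mkcond.
have [Hc _ HM] := aH.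
apply: (alg_sum aH) => i; case im: (i < m)%N; last exact: Hc.
by apply: HM; [exact: Hc|apply: sub_rv_head (hit_in i)].
Qed.

Lemma headsum_step (k : 'I_N) (c : R) p :
  EX (fun t => (headsum k.+1 t + c) ^+ p) =
  (1 - alpha k) * EX (fun t => (headsum k t + c) ^+ p) +
  alpha k * EX (fun t => (headsum k t + (c + L k)) ^+ p).
Proof.
have aH := sub_algebra R (head_events preimage_events k).
have [Hc HD HM] := aH.
have hpow c' : sub_rv (head_events preimage_events k)
    (fun t => (headsum k t + c') ^+ p).
  by apply: (algX aH); apply: HD; [exact: headsum_in|exact: Hc].
have [bc sc] := hpow c; have [bl sl] := hpow (c + L k).
have hdiff : sub_rv (head_events preimage_events k)
    (fun t => (headsum k t + (c + L k)) ^+ p + -1 * (headsum k t + c) ^+ p).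
  by apply: HD => //; apply: HM => //; exact: Hc.
have [bd sd] := hdiff; have [bh sh] := hit_in k.
(* As [hit] is 0 or 1, the power is affine in it; the coefficients depend only on the first k
   variables, so independence splits the expectation with equality. *)
have -> : (fun t => (headsum k.+1 t + c) ^+ p) = (fun t =>
    ((headsum k t + (c + L k)) ^+ p + -1 * (headsum k t + c) ^+ p) * hit k t
    + (headsum k t + c) ^+ p).
  apply: funext => t; rewrite [in LHS]/headsum head_sumS -/(headsum k t) /hit.
  case: eqP => _; rewrite ?mulr1 ?mulr0 ?addr0 ?add0r //.
  by rewrite mulN1r subrK; congr (_ ^+ p); ring.
have bneg := bounded_rvM (bounded_rv_cst T (-1)) bc.
rewrite (EXD P (bounded_rvM bd bh) bc).
rewrite (EX_head preimage_events_measurable hfind (k := k)) // EX_hit.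
by rewrite (EXD P bl bneg) (EXZ P _ bc); ring.
Qed.

Lemma headsum_ae : {ae P, forall t, \sum_(k < N) f k t = headsum N t}.
Proof.
apply: filterS f_hit_ae => t ft; rewrite /headsum.
by apply: eq_big => [i|i _]; rewrite ?ltn_ord.
Qed.

(** Real and imaginary parts of the entries are [f k] or 0, so independence passes from the
    variables to the scalar matrices. *)
Lemma bernoulli_mx_sigma n k :
  mx_sigma (fun t => (cR (f k t))%:M : 'M[complex.complex R]_n) `<=` rv_sigma (f k).
Proof.
apply: smallest_sub; first exact: smallest_sigma_algebra.
move=> A [i [j [B [mB AE]]]].
have sT : rv_sigma (f k) setT by exact: (@measurableT _ (g_sigma_algebraType _)).
have s0 : rv_sigma (f k) set0 by exact: (@measurable0 _ (g_sigma_algebraType _)).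
have scst (r : R) : rv_sigma (f k) ((fun=> r) @^-1` B).
  have [rB|rB] := pselect (B r).
    by rewrite (_ : _ @^-1` B = setT) //; apply/seteqP; split.
  by rewrite (_ : _ @^-1` B = set0) //; apply/seteqP; split.
case: AE => ->; under eq_fun do rewrite mxE; case: (i == j).
- by apply: sub_sigma_algebra; exists B.
- exact: (scst 0).
- exact: (scst 0).
- exact: (scst 0).
Qed.

Lemma headsum_integral (F : R -> R) : measurable_fun setT F ->
  bounded_rv (F \o headsum N) ->
  (\int[P]_t (F (\sum_(k < N) f k t))%:E)%E = (EX (fun t => F (headsum N t)))%:E.
Proof.
move=> mF bF; rewrite -EXE //; have [mFh _] := bF.
have ms : measurable_fun setT (fun t => \sum_(k < N) f k t).
  exact: (alg_sum (measurable_algebra T R)).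
apply: ae_eq_integral => //; try exact/measurable_EFinP.
  by apply/measurable_EFinP; exact: (measurableT_comp mF ms).
by apply: filterS headsum_ae => t ft _; rewrite ft.
Qed.

Lemma bernoulli_admissible n : (0 < n)%N -> (forall k, 0 <= alpha k <= 1) ->
  admissible P L alpha (fun k t => (cR (f k t))%:M : 'M[complex.complex R]_n).
Proof.
move=> n0 halpha; split.
- move=> k i j; split; under eq_fun do rewrite mxE; case: (i == j).
  + exact: hfmeas.
  + exact: (measurable_cst (0 : R)).
  + exact: (measurable_cst (0 : R)).
  + exact: (measurable_cst (0 : R)).
- by move=> A hA; apply: hfind => k; exact: bernoulli_mx_sigma (hA k).
- move=> k; apply: filterS f_hit_ae => t ->; apply: psd_scalar.
  by rewrite mulr_ge0 ?ler0n // ltW.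
- move=> k; apply: filterS f_hit_ae => t ->; rewrite opnorm_scalar //.
    by rewrite ler_piMr ?(ltW (hL k)) // lern1 leq_b1.
  by rewrite mulr_ge0 ?ler0n // ltW.
move=> k; have [bh _] := hit_in k.
have Ef : EX (f k) = L k * alpha k.
  rewrite -EX_hit -EXZ //; apply: ae_eq_EX => //.
    by have [] := bounded_rvM (bounded_rv_cst T (L k)) bh.
  by apply: filterS f_hit_ae.
rewrite (_ : Emx _ _ = (cR (alpha k * L k))%:M).
  by rewrite opnorm_scalar // mulr_ge0 ?(ltW (hL k)) //; case/andP: (halpha k).
apply/matrixP => i j; rewrite !mxE; have [->|ij] := eqVneq i j.
  rewrite mulr1n; congr complex.Complex.
    by rewrite mulrC -Ef; apply: eq_Rintegral => t _; rewrite mxE eqxx.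
  rewrite -[RHS](EX_cst P).
  by apply: eq_Rintegral => t _; rewrite mxE eqxx.
rewrite mulr0n; congr complex.Complex; rewrite -[RHS](EX_cst P);
  by apply: eq_Rintegral => t _; rewrite mxE (negbTE ij).
Qed.

End BernoulliSide.

Lemma rtr_scalar_exp (R : realType) n (c : R) p :
  rtr ((cR c)%:M ^+ p : 'M[complex.complex R]_n) = n%:R * c ^+ p.
Proof.
rewrite -dg_cst dg_exp rtrE -[n in RHS]card_ord -sumr_const mulr_suml.
by apply: eq_bigr => i _; rewrite dgE eqxx mulr1n mul1r.
Qed.

Lemma sum_scalar_mx (R : realType) n I (r : seq I) (p : pred I) (x : I -> R) :
  \sum_(i <- r | p i) (cR (x i))%:M =
  (cR (\sum_(i <- r | p i) x i))%:M :> 'M[complex.complex R]_n.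
Proof.
by elim/big_ind2: _ => // [|A a B b -> ->]; rewrite ?cRD ?raddfD ?raddf0.
Qed.

(** * Comparison of the two recursions *)

Section Comparison.
Variables (R : realType) (p n N : nat) (L alpha : 'I_N -> R).
Hypotheses (hL : forall k, 0 < L k) (halpha : forall k, 0 <= alpha k <= 1).
Context d (T : measurableType d) (P : probability T R).
Variable X : 'I_N -> T -> 'M[complex.complex R]_n.
Hypothesis hX : admissible P L alpha X.
Context d' (T' : measurableType d') (P' : probability T' R).
Variable f : 'I_N -> T' -> R.
Hypothesis hfmeas : forall k, measurable_fun setT (f k).
Hypothesis hfind : indep_family P' (fun k => rv_sigma (f k)).
Hypothesis hfL : forall k, P' (f k @^-1` [set L k]) = (alpha k)%:E.
Hypothesis hf0 : forall k, P' (f k @^-1` [set 0]) = (1 - alpha k)%:E.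

(** Induction on m for all shifts at once, since a step uses the shifts c and c + L m. Both weights
    are nonnegative because alpha lies in [0, 1], so the two bounds add up; with no variables both
    sides are n c^p. *)
Lemma headmx_le_headsum m (c : R) : (m <= N)%N -> 0 <= c ->
  Rintegral P setT (fun t => rtr ((headmx L X m t + (cR c)%:M) ^+ p)) <=
  n%:R * Rintegral P' setT (fun t => (headsum L f m t + c) ^+ p).
Proof.
elim: m c => [|m IH] c mN c0.
  have -> : headmx L X 0 = fun=> 0.
    by apply: funext => t; rewrite /headmx big_pred0.
  have -> : headsum L f 0 = fun=> 0.
    by apply: funext => t; rewrite /headsum big_pred0.
  by rewrite !EX_cst !add0r rtr_scalar_exp.
have -> : m = Ordinal mN by [].
rewrite (headsum_step hfmeas hfind hfL).
apply: le_trans (headmx_step hL hX _ _ c0) _.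
have /andP[a0 a1] := halpha (Ordinal mN).
rewrite mulrDr (mulrCA n%:R) (mulrCA n%:R (alpha _)).
apply: lerD; apply: ler_wpM2l; rewrite ?subr_ge0 //.
  exact: IH (ltnW mN) c0.
by apply: IH (ltnW mN) _; rewrite addr_ge0 // ltW.
Qed.

(** Truncation changes the integrand only on a null set, and the truncated one is bounded, so the
    extended integral is real. *)
Lemma Etrpow_headmx :
  Etrpow P p X = (Rintegral P setT (fun t => rtr (headmx L X N t ^+ p)))%:E.
Proof.
case: (hX) => mX _ _ _ _; have mA := measurable_algebra T R.
have bh : bounded_rv (fun t => rtr (headmx L X N t ^+ p)).
  apply: (alg_rtr (bounded_algebra T R)); apply: (mx_inX (bounded_algebra T R)).
  exact: sub_bounded (headmx_in hL hX N).
rewrite -(EXE P bh); have [mh _] := bh.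
apply: ae_eq_integral.
- exact: measurableT.
- apply/measurable_EFinP; apply: (alg_rtr mA (W := fun t => (\sum_(k < N) X k t) ^+ p)).
  by apply: (mx_inX mA); exact: (mx_in_sum mA).
- exact/measurable_EFinP.
apply: filterS (clipmx_ae hX) => t Et _.
have -> : headmx L X N t = \sum_(k < N) X k t; last by [].
rewrite /headmx; apply: eq_big => [i|i _]; first by rewrite ltn_ord.
by rewrite Et.
Qed.

End Comparison.

Theorem theorem1p1 (R : realType) (p n N : nat)
  (hp : (1 <= p)%N) (hn : (1 <= n)%N) (hN : (1 <= N)%N)
  (L alpha : 'I_N -> R)
  (hL : forall k, 0 < L k) (halpha : forall k, 0 <= alpha k <= 1)
  (* the Bernoulli family f_k on some probability space *)
  (d' : measure_display) (T' : measurableType d') (P' : probability T' R)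
  (f : 'I_N -> T' -> R)
  (hfmeas : forall k, measurable_fun setT (f k))
  (hfind : indep_family P' (fun k => rv_sigma (f k)))
  (hfL : forall k, P' (f k @^-1` [set L k]) = (alpha k)%:E)
  (hf0 : forall k, P' (f k @^-1` [set 0]) = (1 - alpha k)%:E)
  (* an arbitrary admissible family X_k on some probability space *)
  (d : measure_display) (T : measurableType d) (P : probability T R)
  (X : 'I_N -> T -> 'M[complex R]_n)
  (hX : admissible P L alpha X) :
  admissible P' L alpha (fun k t => (cR (f k t))%:M : 'M[complex R]_n) /\
  (Etrpow P p X <= Etrpow P' p (fun k t => (cR (f k t))%:M : 'M[complex R]_n))%E /\
  Etrpow P' p (fun k t => (cR (f k t))%:M : 'M[complex R]_n)
    = (n%:R%:E * \int[P']_t ((\sum_(k < N) f k t) ^+ p)%:E)%E.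
Proof.
have [bs _] := headsum_in L hfmeas N.
have bpow := algX (bounded_algebra T' R) p bs.
have mpow : measurable_fun setT (fun x : R => x ^+ p).
  exact: (algX (measurable_algebra _ R) p (@measurable_id _ _ _)).
have bpowZ := bounded_rvM (bounded_rv_cst T' (n%:R)) bpow.
have mpowZ := measurable_funM (measurable_cst (n%:R : R)) mpow.
have EpowE := headsum_integral hL hfmeas hfL hf0 mpow bpow.
have EZ : Etrpow P' p (fun k t => (cR (f k t))%:M : 'M[complex R]_n) =
    (n%:R * Rintegral P' setT (fun t => headsum L f N t ^+ p))%:E.
  rewrite -(EXZ P' _ bpow) -(headsum_integral hL hfmeas hfL hf0 mpowZ bpowZ).
  apply: eq_integral => t _; rewrite sum_scalar_mx.
  by congr (_%:E); exact: rtr_scalar_exp.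
split; first exact: bernoulli_admissible.
split; last by rewrite EZ EpowE EFinM.
rewrite EZ (Etrpow_headmx p hL hX) lee_fin.
have := headmx_le_headsum p hL halpha hX hfmeas hfind hfL (leqnn N) (lexx 0).
have -> : (cR 0)%:M = 0 :> 'M[complex R]_n by exact: raddf0.
have -> : (fun t => rtr ((headmx L X N t + 0) ^+ p))
    = fun t => rtr (headmx L X N t ^+ p).
  by apply: funext => t; rewrite addr0.
suff -> : (fun t => (headsum L f N t + 0) ^+ p) = fun t => headsum L f N t ^+ p by [].
by apply: funext => t; rewrite addr0.
Qed.
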